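(* There exist universal constants $c_1, C, C'>0$ such that the following holds. Let $\bm{M}^\star\in\mathbb{R}^{n\times n}$ be a rank-$r$ symmetric matrix with incoherence parameter $\mu$, nonzero eigenvalues $\lambda_{\max}^\star=|\lambda_1^\star|\ge\cdots\ge|\lambda_r^\star|=\lambda_{\min}^\star>0$ and corresponding orthonormal eigenvectors $\bm{u}_1^\star,\dots,\bm{u}_r^\star$, and put $\kappa=\lambda_{\max}^\star/\lambda_{\min}^\star$. Let $\bm{M}=\bm{M}^\star+\bm{H}$, where the random matrix $\bm{H}$ satisfies the noise assumption with parameters $\sigma,B$ (see context), and suppose $$\frac{\max\{\sigma\sqrt{n\log n},\,B\log n\}}{\lambda_{\max}^\star}\le\frac{c_1}{\kappa}.$$ Let $\lambda_1,\dots,\lambda_r$ be the top-$r$ eigenvalues of $\bm{M}$ and $\bm{u}_1,\dots,\bm{u}_r$ the corresponding normalized eigenvectors. Then for any fixed unit vector $\bm{a}\in\mathbb{R}^n$ and any $1\le l\le r$, with probability at least $1-C'n^{-10}$, $$\Bigg|\bm{a}^\top\Bigg(\bm{u}_l-\sum_{j=1}^r\frac{\lambda_j^\star\,\bm{u}_j^{\star\top}\bm{u}_l}{\lambda_l}\bm{u}_j^\star\Bigg)\Bigg|\le C\max\{\sigma\sqrt{n\log n},\,B\log n\}\,\frac{\kappa}{|\lambda_l|}\sqrt{\frac{\mu r}{n}}$$ and $$\max\{\sigma\sqrt{n\log n},\,B\log n\}\,\frac{\kappa}{|\lambda_l|}\sqrt{\frac{\mu r}{n}}\le C\,\frac{\max\{\sigma\sqrt{n\log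 n},\,B\log n\}}{\lambda_{\max}^\star}\,\kappa^2\sqrt{\frac{\mu r}{n}}.$$
   Context: Noise assumption with parameters $\sigma=\sigma_n\ge 0$, $B=B_n>0$ on a random matrix $\bm{H}=[H_{ij}]\in\mathbb{R}^{n\times n}$: (1) the entries $H_{ij}$, $1\le i,j\le n$, are independent (no symmetry is imposed, and they need not be identically distributed); (2) $\mathbb{E}[H_{ij}]=0$; (3) $\mathrm{Var}(H_{ij})\le\sigma^2$; (4) each $H_{ij}$ satisfies either (a) $|H_{ij}|\le B$, or (b) $H_{ij}$ has a symmetric distribution with $\mathbb{P}\{|H_{ij}|>B\}\le c_{\mathrm b}n^{-12}$, where $c_{\mathrm b}>0$ is a fixed universal constant. Incoherence parameter: with eigen-decomposition $\bm{M}^\star=\bm{U}^\star\bm{\Sigma}^\star\bm{U}^{\star\top}$, $\bm{U}^\star=[\bm{u}_1^\star,\dots,\bm{u}_r^\star]\in\mathbb{R}^{n\times r}$, $\bm{\Sigma}^\star=\mathrm{diag}(\lambda_1^\star,\dots,\lambda_r^\star)$, $\mu$ is the smallest number such that every entry of $\bm{U}^\star$ has magnitude at most $\sqrt{\mu/n}$. The top-$r$ eigenvalues of the (generally asymmetric) matrix $\bm{M}$ are the $r$ (possibly complex) eigenvalues of largest modulus, ordered so that $|\lambda_1|\ge\cdots\ge|\lambda_r|$; $\bm{u}_l$ is a (possibly complex, right) eigenvector of $\bm{M}$ associated with $\lambda_l$ with $\|\bm{u}_l\|_2=1$. *)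

(* Defs.v *)
From mathcomp Require Export all_boot all_order all_algebra.
From mathcomp Require Export all_classical all_reals all_analysis.
From mathcomp.real_closed Require Export complex.
Export Order.TTheory GRing.Theory Num.Theory.
Export numFieldNormedType.Exports.

Global Set Implicit Arguments.
Global Unset Strict Implicit.
Global Unset Printing Implicit Defensive.

Global Open Scope classical_set_scope.
Global Open Scope ring_scope.
Global Open Scope complex_scope.

(* The modulus with values in R; the generic `|z| on R[i] takes values in R[i]. *)
Notation cmod := ComplexField.Normc.normc.

(** Linear algebra *)

Definition cembed (R : realType) (m n : nat) (A : 'M[R]_(m, n)) :
  'M[R[i]]_(m, n) := map_mx (real_complex R) A.

Definition l2norm (R : realType) (n : nat) (v : 'cV[R]_n) : R :=
  Num.sqrt (\sum_i v i 0 ^+ 2).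

Definition cl2norm (R : realType) (n : nat) (v : 'cV[R[i]]_n) : R :=
  Num.sqrt (\sum_i cmod (v i 0) ^+ 2).

(* Mstar is symmetric of rank r, with nonzero eigenvalues lam ordered by
   decreasing modulus and orthonormal eigenvectors the columns of U. *)
Record low_rank_eigendecomp (R : realType) (n r : nat) (Mstar : 'M[R]_n)
    (U : 'M[R]_(n, r)) (lam : 'rV[R]_r) : Prop := {
  led_sym : Mstar^T = Mstar;
  led_rank : \rank Mstar = r;
  led_orthonormal : U^T *m U = 1%:M;
  led_decomp : Mstar = U *m diag_mx lam *m U^T;
  led_sorted : forall i j : 'I_r, (i <= j)%N -> `|lam 0 j| <= `|lam 0 i|;
  led_neq0 : forall i : 'I_r, lam 0 i != 0
}.

Definition lambda_max (R : realType) (r : nat) (r_gt0 : (0 < r)%N)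
  (lam : 'rV[R]_r) : R := `|lam 0 (Ordinal r_gt0)|.

Definition lambda_min (R : realType) (r : nat) (r_gt0 : (0 < r)%N)
  (lam : 'rV[R]_r) : R := `|lam 0 (rev_ord (Ordinal r_gt0))|.

Definition condition_number (R : realType) (r : nat) (r_gt0 : (0 < r)%N)
  (lam : 'rV[R]_r) : R := lambda_max r_gt0 lam / lambda_min r_gt0 lam.

Definition entrywise_bound (R : realType) (n r : nat) (U : 'M[R]_(n, r))
  (mu : R) : Prop :=
  0 <= mu /\ forall i j, `|U i j| <= Num.sqrt (mu / n%:R).

Definition incoherence_parameter (R : realType) (n r : nat)
    (U : 'M[R]_(n, r)) (mu : R) : Prop :=
  entrywise_bound U mu /\ forall nu, entrywise_bound U nu -> mu <= nu.

(* Eigenvalues are counted with algebraic multiplicity; when |lambda_r| =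
   |lambda_(r+1)|, or when moduli are tied, any admissible choice is allowed. *)
Definition top_eigenvalues (R : realType) (n r : nat) (M : 'M[R[i]]_n)
    (lam : 'I_r -> R[i]) : Prop :=
  exists s : seq R[i],
    [/\ char_poly M = \prod_(z <- s) ('X - z%:P),
        sorted (fun x y => cmod y <= cmod x) s,
        (r <= size s)%N
      & forall l : 'I_r, lam l = s`_l].

(* A right eigenvector, unlike the left ones of [eigenspace]. *)
Definition unit_eigenvector (R : realType) (n : nat) (M : 'M[R[i]]_n)
    (z : R[i]) (u : 'cV[R[i]]_n) : Prop :=
  M *m u = z *: u /\ cl2norm u = 1.

(** Probability *)

Definition mutually_independent (d : measure_display) (T : measurableType d)
    (R : realType) (P : probability T R) (I : finType)
    (X : I -> {RV P >-> R}) : Prop :=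
  forall (J : {set I}) (E : I -> set R),
    (forall i, i \in J -> measurable (E i)) ->
    P (\bigcap_(i in [set` J]) (X i @^-1` E i)) =
    (\prod_(i in J) P (X i @^-1` E i))%E.

Definition symmetric_distribution (d : measure_display) (T : measurableType d)
    (R : realType) (P : probability T R) (X : {RV P >-> R}) : Prop :=
  forall E : set R, measurable E ->
    P [set w | E (X w)] = P [set w | E (- X w)].

(* No measurability of E is required: E contains an event of probability at
   least p, which for measurable E amounts to p <= P E. *)
Definition with_probability_at_least (d : measure_display)
    (T : measurableType d) (R : realType) (P : probability T R) (p : R)
    (E : set T) : Prop :=
  exists A : set T, [/\ measurable A, A `<=` E & (p%:E <= P A)%E].

Record noise_assumption (d : measure_display) (T : measurableType d)
    (R : realType) (P : probability T R) (cb : R) (n : nat) (sigma B : R)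
    (H : 'I_n -> 'I_n -> {RV P >-> R}) : Prop := {
  noise_sigma_ge0 : 0 <= sigma;
  noise_B_gt0 : 0 < B;
  noise_independent :
    mutually_independent (fun ij : 'I_n * 'I_n => H ij.1 ij.2);
  noise_mean0 : forall i j, ('E_P[H i j] = 0)%E;
  noise_variance : forall i j, ('V_P[H i j] <= (sigma ^+ 2)%:E)%E;
  noise_tail : forall i j,
    {ae P, forall w, (`|H i j w| <= B)%R} \/
    (symmetric_distribution (H i j) /\
     (P [set w | (B < `|H i j w|)%R] <= (cb * n%:R ^- 12)%:E)%E)
}.

Definition random_matrix (d : measure_display) (T : measurableType d)
    (R : realType) (P : probability T R) (n : nat)
    (H : 'I_n -> 'I_n -> {RV P >-> R}) (w : T) : 'M[R]_n :=
  \matrix_(i, j) H i j w.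

Definition noise_level (R : realType) (n : nat) (sigma B : R) : R :=
  Num.max (sigma * Num.sqrt (n%:R * ln n%:R)) (B * ln n%:R).

(* a^T (u - sum_j (lamstar_j (ustar_j^T u) / z) ustar_j), ustar_j the j-th
   column of U. *)
Definition linear_form_error (R : realType) (n r : nat) (U : 'M[R]_(n, r))
    (lamstar : 'rV[R]_r) (a : 'cV[R]_n) (z : R[i]) (u : 'cV[R[i]]_n) : R[i] :=
  ((cembed a)^T *m
   (u - \sum_(j < r)
          ((lamstar 0 j)%:C * ((cembed (col j U))^T *m u) 0 0 / z)
            *: cembed (col j U))) 0 0.

(* Main.v *)
(** Truncate the noise at level B; off an event of probability O(n^-10) this
    changes nothing, and it keeps the entries centred.  Two moment estimates
    then control the truncated matrix, with L the noise level and h = C L.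
    Expanding E (a^T H^s v)^(2k) and E tr (H^T H)^k over walks, an edge visited
    once contributes 0 by independence.  The other configurations are encoded
    by the map sending each step to a representative step using the same edge,
    together with the heads of the representative steps; hence both moments
    are at most a constant times (C' L)^N for words of length N ~ log n, and
    Markov's inequality gives, with high probability,
      |H x| <= h |x|  and  |a^T H^s u_j| <= h^s sqrt(mu/n)  for 1 <= s <= log2 n.
    On this event the cone {|x - U U^T x| <= |U^T x|} is preserved by M - z
    whenever |z| <= lambda_min / 4, so a product of n - r + 1 such factors
    cannot annihilate a vector of the range of U; therefore the r largest
    eigenvalues have modulus at least lambda_min / 4.  Finally
      u_l - M* u_l / lambda_l =
        sum_(1 <= s <= log2 n) H^s M* u_l / lambda_l^(s+1) + remainder,
    a truncated Neumann series whose terms decay geometrically. *)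
Require Import Defs.
From mathcomp Require Import measurable_realfun ring lra zify.

(** * Expectations of bounded random variables *)

Section BoundedExpectation.
Context (d : measure_display) (T : measurableType d) (R : realType).
Variable P : probability T R.

(** Such functions form a ring, and all are integrable against [P]; expectations can then be handled
    as real-valued integrals without further integrability conditions. *)
Definition bounded_measurable (f : T -> R) : Prop :=
  measurable_fun [set: T] f /\ exists K, forall w, `|f w| <= K.

Local Notation bm := bounded_measurable.
Local Notation Ex f := (Rintegral P setT f).

Lemma bm_cst c : bm (fun=> c).
Proof. by split; [exact: measurable_cst | exists `|c|]. Qed.

Lemma bm_add f g : bm f -> bm g -> bm (fun w => f w + g w).
Proof.
move=> [mf [K fK]] [mg [K' gK]]; split; first exact: measurable_funD.
by exists (K + K') => w; rewrite (le_trans (ler_normD _ _)) // lerD.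
Qed.

Lemma bm_mul f g : bm f -> bm g -> bm (fun w => f w * g w).
Proof.
move=> [mf [K fK]] [mg [K' gK]]; split; first exact: measurable_funM.
by exists (K * K') => w; rewrite normrM ler_pM.
Qed.

Lemma bm_abs f : bm f -> bm (fun w => `|f w|).
Proof.
move=> [mf [K fK]]; split; first exact: measurableT_comp.
by exists K => w; rewrite normr_id.
Qed.

Lemma bm_indic A : measurable A -> bm (\1_A).
Proof.
move=> mA; split; first exact: measurable_indic.
by exists 1 => w; rewrite indicE ger0_norm// ; case: (_ \in _).
Qed.

Lemma bm_sum I (s : seq I) (Q : pred I) (f : I -> T -> R) :
  (forall i, bm (f i)) -> bm (fun w => \sum_(i <- s | Q i) f i w).
Proof.
move=> bf; elim: s => [|i s IH].
  by under eq_fun do rewrite big_nil; exact: bm_cst.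
under eq_fun do rewrite big_cons.
by case: (Q i) => //; exact: bm_add.
Qed.

Lemma bm_prod I (s : seq I) (Q : pred I) (f : I -> T -> R) :
  (forall i, bm (f i)) -> bm (fun w => \prod_(i <- s | Q i) f i w).
Proof.
move=> bf; elim: s => [|i s IH].
  by under eq_fun do rewrite big_nil; exact: bm_cst.
under eq_fun do rewrite big_cons.
by case: (Q i) => //; exact: bm_mul.
Qed.

Lemma bm_exp f m : bm f -> bm (fun w => f w ^+ m).
Proof.
move=> bf; elim: m => [|m IH]; first exact: bm_cst.
by under eq_fun do rewrite exprS; exact: bm_mul.
Qed.

Lemma bm_comp (phi : R -> R) (X : T -> R) (K : R) : measurable_fun [set: R] phi ->
  (forall x, `|phi x| <= K) -> measurable_fun [set: T] X ->
  bm (fun w => phi (X w)).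
Proof.
by move=> mphi bphi mX; split; [exact: measurableT_comp | exists K].
Qed.

Lemma bm_integrable f : bm f -> P.-integrable setT (EFin \o f).
Proof.
move=> [mf [K fK]]; apply: measurable_bounded_integrable => //.
  by rewrite (le_lt_trans (probability_le1 _ _)) ?ltry.
exists K; split; first by rewrite num_real.
by move=> x xK w _ /=; rewrite (le_trans (fK w)) // ltW.
Qed.

Lemma Ex_cst c : Ex (fun=> c) = c.
Proof.
by rewrite Rintegral_cst // (congr1 fine (probability_setT P)) mulr1.
Qed.

Lemma Ex_add f g : bm f -> bm g -> Ex (fun w => f w + g w) = Ex f + Ex g.
Proof. by move=> bf bg; rewrite RintegralD //; exact: bm_integrable. Qed.

Lemma Ex_scale c f : bm f -> Ex (fun w => c * f w) = c * Ex f.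
Proof. by move=> bf; rewrite RintegralZl //; exact: bm_integrable. Qed.

Lemma Ex_sub f g : bm f -> bm g -> Ex (fun w => f w - g w) = Ex f - Ex g.
Proof. by move=> bf bg; rewrite RintegralB //; exact: bm_integrable. Qed.

Lemma Ex_sum I (s : seq I) (Q : pred I) (f : I -> T -> R) :
  (forall i, bm (f i)) ->
  Ex (fun w => \sum_(i <- s | Q i) f i w) = \sum_(i <- s | Q i) Ex (f i).
Proof.
move=> bf; elim: s => [|i s IH].
  by under eq_Rintegral do rewrite big_nil; rewrite Ex_cst big_nil.
under eq_Rintegral do rewrite big_cons.
rewrite big_cons; case: (Q i) => //.
by rewrite Ex_add ?IH //; exact: bm_sum.
Qed.

Lemma Ex_le f g : bm f -> bm g -> (forall w, f w <= g w) -> Ex f <= Ex g.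
Proof. by move=> bf bg fg; apply: le_Rintegral => //; exact: bm_integrable. Qed.

Lemma Ex_abs_le f K : bm f -> (forall w, `|f w| <= K) -> `|Ex f| <= K.
Proof.
move=> bf fK; apply: (le_trans (le_normr_Rintegral _ (bm_integrable bf))) => //.
by rewrite -[leRHS]Ex_cst; apply: Ex_le => //; [exact: bm_abs|exact: bm_cst].
Qed.

Lemma Ex_indic A : measurable A -> Ex (\1_A) = fine (P A).
Proof. by move=> mA; rewrite /Rintegral integral_indic // setIT. Qed.

Lemma markov_Ex f (t : R) : 0 < t -> bm f -> (forall w, 0 <= f w) ->
  (P [set w | (t <= f w)%R] <= (Ex f / t)%:E)%E.
Proof.
move=> t0 bf f0.
have mA : measurable [set w | t <= f w].
  by have := measurable_fun_ler (measurable_cst t) (proj1 bf);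
     move=> /(_ measurableT [set true] I); rewrite setTI.
rewrite -[leLHS]fineK ?fin_num_measure // lee_fin ler_pdivlMr //.
rewrite -Ex_indic // mulrC -Ex_scale; last exact: bm_indic.
apply: Ex_le => // [|w]; first by apply: bm_mul; [exact: bm_cst|exact: bm_indic].
rewrite indicE; have [|_] := boolP (w \in _); last by rewrite mulr0.
by rewrite inE /= mulr1.
Qed.

End BoundedExpectation.

(** * Step functions and comparison of laws *)

Section StepApproximation.
Context (R : realType).

(** The range [-K, K] is cut into levels of width 1/M: [D j] is the preimage of the j-th level and
    [c j] is its lower end. *)
Lemma step_approximation (phi : R -> R) (K : R) (M : nat) :
  measurable_fun [set: R] phi -> (forall x, `|phi x| <= K) -> (0 < M)%N ->
  exists (N : nat) (c : 'I_N -> R) (D : 'I_N -> set R),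
    (forall j, measurable (D j)) /\
    forall x, `|phi x - \sum_j c j * \1_(D j) x| <= M%:R^-1.
Proof.
move=> mphi bphi M0.
have M0R : 0 < M%:R :> R by rewrite ltr0n.
have psi_ge0 x : 0 <= (phi x + K) * M%:R.
  by rewrite mulr_ge0 ?ler0n //; have := bphi x; rewrite ler_norml; lra.
(* The rescaled value (phi x + K) M lies in [0, 2 K M], so its integer part takes at most [N]
   values. *)
pose N := (Num.truncn (2 * K * M%:R)).+1.
pose lev x := Num.truncn ((phi x + K) * M%:R).
have levP x : (lev x)%:R <= (phi x + K) * M%:R < (lev x).+1%:R.
  exact: truncn_itv.
have levN x : (lev x < N)%N.
  rewrite ltnS le_truncn // ler_wpM2r ?ler0n //.
  by have := bphi x; rewrite ler_norml; lra.
exists N, (fun j : 'I_N => j%:R / M%:R - K),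
  (fun j : 'I_N => phi @^-1` [set` `[j%:R / M%:R - K, j.+1%:R / M%:R - K[ ]).
split=> [j|x]; first by rewrite -[X in measurable X]setTI; exact: mphi.
have inD (j : 'I_N) : (x \in phi @^-1` [set` `[j%:R / M%:R - K, j.+1%:R / M%:R - K[ ])
    = (lev x == j).
  rewrite truncn_eq // -ler_pdivrMr // -ltr_pdivlMr // -lerBlDr -ltrBrDr.
  by apply/idP/idP; rewrite inE /= in_itv.
rewrite (bigD1 (Ordinal (levN x))) //= big1 => [|j jx]; last first.
  by rewrite indicE inD eq_sym -val_eqE /= in jx *; rewrite (negbTE jx) mulr0.
rewrite indicE (inD (Ordinal (levN x))) /= eqxx mulr1 addr0.
have /andP[l1 l2] := levP x.
have E : (phi x + K) * M%:R / M%:R = phi x + K by rewrite mulfK // gt_eqF.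
have -> : phi x - ((lev x)%:R / M%:R - K) =
    ((phi x + K) * M%:R - (lev x)%:R) / M%:R by rewrite mulrBl E; ring.
rewrite normrM normfV [`|M%:R|]ger0_norm ?ler0n // ler_piMl ?invr_ge0 ?ler0n //.
by rewrite -natr1 in l2; rewrite ler_norml; apply/andP; split; lra.
Qed.

End StepApproximation.

Section Transfer.
Context (d : measure_display) (T : measurableType d) (R : realType).
Variable P : probability T R.
Local Notation bm := (@bounded_measurable d T R).
Local Notation Ex f := (Rintegral P setT f).

(** Agreement on indicators extends by linearity to step functions. Approximating [phi] within 1/M
    leaves a gap of at most (KZ + KZ')/M, for every M. The weights serve independence, where [Z] is
    the product of the other factors; symmetry uses constant weights and [Y] = -[X]. *)
Lemma Ex_transfer (X Y Z Z' : T -> R) (phi : R -> R) (K : R) :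
  measurable_fun [set: T] X -> measurable_fun [set: T] Y -> bm Z -> bm Z' ->
  (forall E, measurable E ->
     Ex (fun w => \1_E (X w) * Z w) = Ex (fun w => \1_E (Y w) * Z' w)) ->
  measurable_fun [set: R] phi -> (forall x, `|phi x| <= K) ->
  Ex (fun w => phi (X w) * Z w) = Ex (fun w => phi (Y w) * Z' w).
Proof.
move=> mX mY bZ bZ' XY mphi bphi.
have [_ [KZ ZK]] := bZ; have [_ [KZ' ZK']] := bZ'.
have ind_bm (X' : T -> R) (E : set R) : measurable_fun [set: T] X' -> measurable E ->
    bm (fun w => \1_E (X' w)).
  move=> mX' mE; apply: (@bm_comp _ _ _ (\1_E) X' 1) => // x.
  by rewrite indicE ger0_norm //; case: (_ \in _).
have key (M : nat) : (0 < M)%N -> `|Ex (fun w => phi (X w) * Z w) -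
    Ex (fun w => phi (Y w) * Z' w)| <= M%:R^-1 * (KZ + KZ').
  move=> M0; have [N [c [D [mD Dphi]]]] := step_approximation mphi bphi M0.
  pose st x := \sum_j c j * \1_(D j) x.
  have st_bm (X' : T -> R) : measurable_fun [set: T] X' -> bm (fun w => st (X' w)).
    by move=> mX'; apply: bm_sum => j; apply: bm_mul; [exact: bm_cst|exact: ind_bm].
  have Est (X' V : T -> R) : measurable_fun [set: T] X' -> bm V ->
      Ex (fun w => st (X' w) * V w) =
      \sum_j c j * Ex (fun w => \1_(D j) (X' w) * V w).
    move=> mX' bV.
    under eq_Rintegral do rewrite mulr_suml.
    rewrite Ex_sum => [|j]; last first.
      by apply: bm_mul => //; apply: bm_mul; [exact: bm_cst|exact: ind_bm].
    apply: eq_bigr => j _; rewrite -Ex_scale; last by apply: bm_mul => //; exact: ind_bm.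
    by apply: eq_Rintegral => w _; rewrite mulrA.
  have diff (X' V : T -> R) (KV : R) : measurable_fun [set: T] X' -> bm V ->
      (forall w, `|V w| <= KV) ->
      `|Ex (fun w => phi (X' w) * V w) - Ex (fun w => st (X' w) * V w)|
        <= M%:R^-1 * KV.
    move=> mX' bV VK; have bphiX := bm_comp mphi bphi mX'.
    rewrite -Ex_sub; [|exact: bm_mul|by apply: bm_mul => //; exact: st_bm].
    apply: Ex_abs_le => [|w].
      under eq_fun do rewrite -mulrBl.
      apply: bm_mul bV; apply: bm_add => //.
      by under eq_fun do rewrite -mulN1r; apply: bm_mul; [exact: bm_cst|exact: st_bm].
    by rewrite -mulrBl normrM ler_pM.
  have stE : Ex (fun w => st (X w) * Z w) = Ex (fun w => st (Y w) * Z' w).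
    by rewrite !Est //; apply: eq_bigr => j _; rewrite XY.
  have := diff X Z KZ mX bZ ZK; have := diff Y Z' KZ' mY bZ' ZK'.
  by rewrite stE mulrDr !ler_norml => /andP[? ?] /andP[? ?]; apply/andP; split; lra.
apply/eqP; rewrite -subr_eq0 -normr_le0 leNgt; apply/negP => gap.
set e := `|_| in gap key.
have KK : 0 <= KZ + KZ'.
  by rewrite addr_ge0 // (le_trans (normr_ge0 _) (ZK point), le_trans (normr_ge0 _) (ZK' point)).
pose M := (Num.truncn ((KZ + KZ') / e)).+1.
have : (KZ + KZ') / e < M%:R by exact: truncnS_gt.
rewrite ltr_pdivrMr // mulrC => lt1.
have := key M isT; rewrite ler_pdivlMl ?ltr0n // mulrC leNgt => /negP; exact.
Qed.

End Transfer.

(** * Product rule for independent variables *)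

Section Independence.
Context (d : measure_display) (T : measurableType d) (R : realType).
Variable P : probability T R.
Local Notation bm := (@bounded_measurable d T R).
Local Notation Ex f := (Rintegral P setT f).

Lemma indic_bounded (E : set R) (x : R) : `|\1_E x| <= 1 :> R.
Proof. by rewrite indicE ger0_norm //; case: (_ \in _). Qed.

Lemma independent_Ex_prod_indic (I : finType) (X : I -> {RV P >-> R})
    (E : I -> set R) : mutually_independent X -> (forall i, measurable (E i)) ->
  Ex (fun w => \prod_i \1_(E i) (X i w)) =
  \prod_i Ex (fun w => \1_(E i) (X i w)).
Proof.
move=> indX mE.
have mXE i : measurable (X i @^-1` E i).
  by rewrite -[X in measurable X]setTI; apply: measurable_funP.
have -> : (fun w => \prod_i \1_(E i) (X i w)) =
    \1_(\bigcap_(i in [set` [set: I]%SET]) (X i @^-1` E i)) :> (T -> R).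
  apply/funext => w; rewrite indicE; have [Ew|nEw] := boolP (w \in _).
    rewrite big1 // => i _; rewrite indicE mem_set //.
    by move: Ew; rewrite inE; apply; rewrite /= inE.
  have [i nEi] : exists i, ~ E i (X i w).
    apply/existsNP => Ei; move/negP: nEw; apply.
    by rewrite inE => i _; exact: Ei.
  by rewrite (bigD1 i) //= indicE memNset // mul0r.
rewrite Ex_indic; last first.
  by apply: fin_bigcap_measurable => // i _; exact: mXE.
rewrite indX //.
rewrite (eq_bigr (fun i => (fine (P (X i @^-1` E i)))%:E)) => [|i _]; last first.
  by rewrite fineK // fin_num_measure.
rewrite prodEFin /=; apply: eq_big => [i|i _]; first by rewrite inE.
by rewrite -Ex_indic.
Qed.

(** Indicators are replaced by general factors one index at a time: the induction is on a list of
    indices outside which every factor is an indicator. *)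
Lemma independent_Ex_prod (I : finType) (X : I -> {RV P >-> R})
    (phi : I -> R -> R) (K : I -> R) :
  mutually_independent X -> (forall i, measurable_fun [set: R] (phi i)) ->
  (forall i x, `|phi i x| <= K i) ->
  Ex (fun w => \prod_i phi i (X i w)) = \prod_i Ex (fun w => phi i (X i w)).
Proof.
move=> indX; have : forall i, i \notin enum I ->
    exists E, measurable E /\ phi i = \1_E by move=> i; rewrite mem_enum.
elim: (enum I) phi K => [|e s IH] phi K ind mphi bphi.
  have /choice [E phiE] : forall i, exists E, measurable E /\ phi i = \1_E.
    by move=> i; exact: ind.
  under eq_Rintegral do under eq_bigr do rewrite (proj2 (phiE _)).
  rewrite independent_Ex_prod_indic // => [|i]; last exact: (proj1 (phiE i)).
  by apply: eq_bigr => i _; rewrite (proj2 (phiE i)).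
have mX i : measurable_fun [set: T] (X i) by exact: measurable_funP.
have bphiX i : bm (fun w => phi i (X i w)) by apply: bm_comp (bphi i) _.
pose c := \prod_(i | i != e) Ex (fun w => phi i (X i w)).
under eq_Rintegral do rewrite (bigD1 e) //=.
rewrite [RHS](bigD1 e) //= -/c.
(* The product of the other factors is traded for the constant [c]. By transfer this need only be
   checked with an indicator in place of [phi e], which takes [e] off the list. *)
rewrite (@Ex_transfer _ _ _ P (X e) (X e) _ (fun=> c) (phi e) (K e)) //.
- by under eq_Rintegral do rewrite mulrC; rewrite Ex_scale // mulrC.
- exact: bm_prod.
- exact: bm_cst.
move=> E mE; pose phi' i := if i == e then \1_E else phi i.
have phi'c : \prod_i Ex (fun w => phi' i (X i w)) =
    Ex (fun w => \1_E (X e w)) * c.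
  rewrite (bigD1 e) //= /phi' eqxx; congr (_ * _).
  by apply: eq_bigr => i /negbTE ->.
transitivity (Ex (fun w => \prod_i phi' i (X i w))).
  apply: eq_Rintegral => w _; rewrite [RHS](bigD1 e) //= {1}/phi' eqxx.
  by congr (_ * _); apply: eq_bigr => i ie; rewrite /phi' (negbTE ie).
under [RHS]eq_Rintegral do rewrite mulrC.
rewrite Ex_scale; last by apply: (bm_comp _ (@indic_bounded E)).
rewrite mulrC -phi'c; apply: (IH _ (fun i => if i == e then 1 else K i)) => i.
- rewrite /phi'; case: eqP => [_ _|/eqP ie nis]; first by exists E.
  by apply: ind; rewrite inE negb_or ie.
- by rewrite /phi'; case: eqP.
- by move=> x; rewrite /phi'; case: eqP => // _; exact: indic_bounded.
Qed.

End Independence.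

(** * Moments of sums over walks *)

Section Representatives.
Context (I Q : finType).
Implicit Types (eps : Q -> I) (e : Q).

(** Two steps have the same representative exactly when they use the same edge, so this map encodes
    the coincidence pattern of a configuration. Taking the first step in the enumeration makes the
    choice canonical and lets a walk be rebuilt from left to right. *)
Definition class_rep eps : {ffun Q -> Q} :=
  [ffun e => [arg min_(e' < e | eps e' == eps e) enum_rank e']%N].

Definition every_edge_repeated eps : bool :=
  [forall e, exists e', (e' != e) && (eps e' == eps e)].

Lemma class_repE eps e : eps (class_rep eps e) = eps e.
Proof. by rewrite ffunE; case: arg_minnP => // e' /eqP. Qed.

Lemma class_rep_min eps e : (enum_rank (class_rep eps e) <= enum_rank e)%N.
Proof. by rewrite ffunE; case: arg_minnP => // e' _; apply. Qed.

Lemma class_rep_eq eps e e' : eps e = eps e' -> class_rep eps e = class_rep eps e'.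
Proof.
move=> ee'; rewrite !ffunE; case: arg_minnP => // r /eqP er rmin.
case: arg_minnP => // r' /eqP er' rmin'.
apply: enum_rank_inj; apply: val_inj; apply/eqP; rewrite eqn_leq.
by rewrite rmin ?rmin' // ?er ?er' ?ee'.
Qed.

Lemma class_repK eps e : class_rep eps (class_rep eps e) = class_rep eps e.
Proof. exact/class_rep_eq/class_repE. Qed.

End Representatives.

(* Bounds the sum over all possible [class_rep] maps, without using that they
   are idempotent. *)
Lemma sum_ffun_fixpoint_weight (R : realType) (Q : finType) (q : R) : 0 <= q ->
  \sum_(g : {ffun Q -> Q}) \prod_e (if g e == e then 1 else q)
    <= (1 + #|Q|%:R * q) ^+ #|Q|.
Proof.
move=> q0; rewrite -(bigA_distr_bigA (fun e e' : Q => if e' == e then 1 else q)).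
rewrite -prodr_const; apply: ler_prod => e _; rewrite sumr_ge0 /=; last first.
  by move=> e' _; case: ifP.
rewrite (bigD1 e) //= eqxx lerD2l.
rewrite (eq_bigr (fun=> q)) => [|e' /negbTE ->] //.
by rewrite sumr_const -(mulr_natl q) ler_wpM2r // ler_nat max_card.
Qed.

Section MomentMethod.
Context (d : measure_display) (T : measurableType d) (R : realType).
Variable P : probability T R.
Local Notation bm := (@bounded_measurable d T R).
Local Notation Ex f := (Rintegral P setT f).

Context (I : finType) (Y : I -> T -> R) (L p q : R).
Hypothesis L0 : 0 <= L.
Hypothesis p0 : 0 <= p.
Hypothesis q0 : 0 <= q.
Hypothesis Ybm : forall i, bm (Y i).
Hypothesis Yindep : forall m : I -> nat,
  Ex (fun w => \prod_i Y i w ^+ m i) = \prod_i Ex (fun w => Y i w ^+ m i).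
Hypothesis Ymean : forall i, Ex (Y i) = 0.
Hypothesis Ymoment : forall i m, (2 <= m)%N ->
  `|Ex (fun w => Y i w ^+ m)| <= L ^+ m * p * q ^+ m.-1.

(** Grouping steps by edge, an edge used once contributes its zero mean. For an edge used m >= 2
    times, the factor [p] is charged to its representative step and a factor [q] to each of the m -
    1 others. *)
Lemma Ex_edge_product_le (Q : finType) (eps : Q -> I) :
  `|Ex (fun w => \prod_e Y (eps e) w)| <=
  if every_edge_repeated eps
  then \prod_e (L * (if class_rep eps e == e then p else q)) else 0.
Proof.
pose m i := #|[pred e | eps e == i]|.
have -> : Ex (fun w => \prod_e Y (eps e) w) =
    \prod_i Ex (fun w => Y i w ^+ m i).
  rewrite -Yindep; apply: eq_Rintegral => w _.
  rewrite (partition_big eps predT) //=; apply: eq_bigr => i _.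
  by rewrite (eq_bigr (fun=> Y i w)) ?prodr_const // => e /eqP ->.
case: ifPn => [rpt|]; last first.
  move=> /forallPn[e /existsPn uniq_e]; rewrite (bigD1 (eps e)) //=.
  have -> : m (eps e) = 1%N.
    rewrite /m; apply: (fintype.eq_card1 (x := e)) => e'; rewrite !inE; have := uniq_e e'.
    by rewrite negb_and negbK; case: eqP => [->|_] //=; [rewrite eqxx | move/negbTE].
  by under eq_Rintegral do rewrite expr1; rewrite Ymean mul0r normr0.
rewrite normr_prod [leRHS](partition_big eps predT) //=.
apply: ler_prod => i _; rewrite normr_ge0 /=.
have [m0|m_gt0] := posnP (m i).
  rewrite m0; under eq_Rintegral do rewrite expr0.
  rewrite Ex_cst normr1 big1 // => e ei.
  by move: m0 => /card0_eq /(_ e); rewrite !inE ei.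
have [e0] := card_gt0P m_gt0; rewrite inE => /eqP e0i.
have ri : eps (class_rep eps e0) == i by rewrite class_repE e0i.
have m2 : (2 <= m i)%N.
  have /existsP[e1 /andP[ne1 e1i]] := forallP rpt e0.
  rewrite /m (cardD1 e0) !inE e0i eqxx add1n ltnS; apply/card_gt0P.
  by exists e1; rewrite !inE ne1 (eqP e1i) e0i eqxx.
apply: (le_trans (Ymoment i m2)).
rewrite (bigD1 (class_rep eps e0)) //= class_repK eqxx.
rewrite (eq_bigr (fun=> L * q)) => [|e /andP[/eqP ei ne]]; last first.
  by rewrite (@class_rep_eq _ _ eps e e0) ?ei ?e0i // eq_sym (negbTE ne).
rewrite prodr_const; set k := #|_|.
have -> : k = (m i).-1.
  rewrite /m (cardD1 (class_rep eps e0)) inE ri add1n /=.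
  by apply: eq_card => e; rewrite !inE andbC.
by rewrite -[in leLHS](prednK m_gt0) exprS exprMn le_eqVlt; apply/orP; left; apply/eqP; ring.
Qed.

(** Configurations are grouped by their representative map g. The counting hypothesis absorbs the
    factors [p], one per fixed point of g; the factors [q] that remain are summed over all g by
    [sum_ffun_fixpoint_weight]. *)
Theorem Ex_weighted_sum_le (Q W : finType) (c : W -> R) (eps : W -> Q -> I)
    (w0 : R) :
  (forall g : {ffun Q -> Q},
    \sum_(o | every_edge_repeated (eps o) && (class_rep (eps o) == g)) `|c o|
      * p ^+ #|[pred e | g e == e]| <= w0) ->
  `|Ex (fun w => \sum_o c o * \prod_e Y (eps o e) w)|
    <= w0 * (L * (1 + #|Q|%:R * q)) ^+ #|Q|.
Proof.
move=> cnt; rewrite Ex_sum => [|o]; last first.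
  by apply: bm_mul; [exact: bm_cst | exact: bm_prod].
apply: (le_trans (ler_norm_sum _ _ _)).
pose wt (g : {ffun Q -> Q}) : R := \prod_e (L * (if g e == e then p else q)).
pose wt1 (g : {ffun Q -> Q}) : R := \prod_e (if g e == e then 1 else q).
have wt1_ge0 g : 0 <= wt1 g by apply: prodr_ge0 => e _; case: ifP.
have wtE g : wt g = L ^+ #|Q| * (p ^+ #|[pred e | g e == e]| * wt1 g).
  rewrite /wt big_split /= prodr_const; congr (_ * _).
  rewrite /wt1 (bigID (fun e => g e == e)) /=.
  rewrite (eq_bigr (fun=> p)) => [|e ->] //; rewrite prodr_const.
  congr (_ * _); rewrite [RHS](bigID (fun e => g e == e)) /=.
  rewrite [X in _ = X * _]big1 ?mul1r => [|e ->] //.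
  by apply: eq_bigr => e /negbTE ->.
have w0_ge0 : 0 <= w0.
  apply: le_trans (cnt [ffun e => e]); apply: sumr_ge0 => o _.
  by rewrite mulr_ge0 // exprn_ge0.
apply: (@le_trans _ _ (\sum_(o | every_edge_repeated (eps o))
    `|c o| * wt (class_rep (eps o)))).
  rewrite [leRHS]big_mkcond /=; apply: ler_sum => o _.
  rewrite Ex_scale; last exact: bm_prod.
  rewrite normrM; have := Ex_edge_product_le (eps o).
  case: ifP => _ h; first by rewrite ler_wpM2l.
  by rewrite (le_trans (ler_wpM2l _ h)) ?mulr0.
rewrite (partition_big (fun o => class_rep (eps o)) predT) //=.
apply: (@le_trans _ _ (\sum_g L ^+ #|Q| * (w0 * wt1 g))).
  apply: ler_sum => g _.
  rewrite (eq_bigr (fun o => `|c o| * p ^+ #|[pred e | g e == e]|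
     * (L ^+ #|Q| * wt1 g))) => [|o /andP[_ /eqP ->]]; last by rewrite wtE; ring.
  rewrite -mulr_suml [leRHS]mulrCA; apply: ler_wpM2r; last exact: cnt.
  by rewrite mulr_ge0 // exprn_ge0.
rewrite -mulr_sumr -mulr_sumr mulrCA ler_wpM2l // exprMn.
by rewrite ler_wpM2l ?exprn_ge0 // sum_ffun_fixpoint_weight.
Qed.

End MomentMethod.

(** * Expansion of matrix products over walks, and counting of walks *)

Notation step_tail := (widen_ord (leqnSn _)).
Notation step_head := (lift ord0).

Section Walks.
Context (R : realType) (n : nat).

(** The factor may depend on its position so that one expansion serves both the powers of A and the
    alternating products of A^T and A. *)
Fixpoint matrix_word (D : nat -> 'M[R]_n) (N : nat) (v : 'cV[R]_n) : 'cV[R]_n :=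
  if N is N'.+1 then D 0%N *m matrix_word (fun t => D t.+1) N' v else v.

Lemma matrix_wordE (D : nat -> 'M[R]_n) (N : nat) (v : 'cV[R]_n) (i : 'I_n) :
  matrix_word D N v i 0 = \sum_(f : {ffun 'I_N.+1 -> 'I_n} | f ord0 == i)
    (\prod_(t < N) D t (f (step_tail t)) (f (step_head t))) * v (f ord_max) 0.
Proof.
elim: N D i => [|N IH] D i.
  rewrite (big_pred1 [ffun=> i]) => [|f] /=; last first.
    apply/eqP/eqP => [fi|->]; last by rewrite ffunE.
    by apply/ffunP => t; rewrite ffunE -fi; congr (f _); apply: val_inj; case: t => [[]].
  by rewrite big_ord0 mul1r ffunE.
(* Prepending the vertex i is a bijection from all walks with N steps onto the walks with N + 1
   steps that start at i. *)
pose cons (g : {ffun 'I_N.+1 -> 'I_n}) : {ffun 'I_N.+2 -> 'I_n} :=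
  [ffun x => if unlift ord0 x is Some y then g y else i].
pose behead (f : {ffun 'I_N.+2 -> 'I_n}) : {ffun 'I_N.+1 -> 'I_n} :=
  [ffun y => f (lift ord0 y)].
have cons0 g : cons g ord0 = i by rewrite ffunE unlift_none.
have consS g y : cons g (lift ord0 y) = g y by rewrite ffunE liftK.
have consK g : behead (cons g) = g by apply/ffunP => y; rewrite ffunE consS.
rewrite (reindex_onto cons behead) /= => [|f /eqP fi]; last first.
  by apply/ffunP => x; case: (unliftP ord0 x) => [y ->|->]; rewrite ?consS ?cons0 ?ffunE.
rewrite (eq_bigl predT) => [|g]; last by rewrite cons0 consK !eqxx.
rewrite mxE (eq_bigr (fun j => \sum_(f : {ffun 'I_N.+1 -> 'I_n} | f ord0 == j)
   D 0%N i j * ((\prod_(t < N) D t.+1 (f (step_tail t)) (f (step_head t))) *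
     v (f ord_max) 0))) => [|j _]; last by rewrite IH mulr_sumr.
rewrite (exchange_big_dep predT) //=; apply: eq_bigr => g _.
rewrite (big_pred1 (g ord0)) => [|j]; last by rewrite eq_sym.
rewrite big_ord_recl mulrA; congr (_ * _ * _).
- have -> : step_tail (ord0 : 'I_N.+1) = ord0 by exact: val_inj.
  by rewrite cons0 consS.
- apply: eq_bigr => t _; rewrite consS.
  by have -> : step_tail (lift ord0 t) = lift ord0 (step_tail t);
     [exact: val_inj | rewrite consS].
- have -> : ord_max = lift ord0 ord_max :> 'I_N.+2 by exact: val_inj.
  by rewrite consS.
Qed.

Lemma matrix_word_const (A : 'M[R]_n) (N : nat) (v : 'cV[R]_n) :
  matrix_word (fun=> A) N v = iter N (mulmx A) v.
Proof. by elim: N => //= N ->. Qed.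

End Walks.

Lemma sum_comp_inj_le (R : numDomainType) (I J : finType) (A : pred I) (h : I -> J)
    (F : J -> R) : {in A &, injective h} -> (forall y, 0 <= F y) ->
  \sum_(x | A x) F (h x) <= \sum_y F y.
Proof.
move=> hinj F0; rewrite -(big_imset F hinj) /=.
rewrite [leRHS](bigID (mem [set h x | x in A]%SET)) /= lerDl.
by apply: sumr_ge0 => y _.
Qed.

Section BilinearWalkCount.
Context (R : realType) (n s K : nat) (a : 'cV[R]_n).
Hypothesis n_gt0 : (0 < n)%N.
Hypothesis a_unit : \sum_i a i 0 ^+ 2 = 1.

Local Notation walks := {ffun 'I_K -> {ffun 'I_s.+2 -> 'I_n}}.
Local Notation pos := ('I_K * 'I_s.+1)%type.

(** Edges are oriented, since the entries (i, j) and (j, i) are independent variables. *)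
Definition bilinear_edge (o : walks) (e : pos) : 'I_n * 'I_n :=
  (o e.1 (step_tail e.2), o e.1 (step_head e.2)).

Lemma unit_entry_le1 i : `|a i 0| <= 1.
Proof.
rewrite -(@expr_le1 _ 2) // real_normK ?num_real // -a_unit (bigD1 i) //= lerDl.
by apply: sumr_ge0 => j _; exact: sqr_ge0.
Qed.

(* The heads of the representative steps determine every start of a walk, except
   the starts x of the edges used as first steps only.  Such an edge is used at
   least twice, so x carries the weight a_x^2, and these weights sum to 1. *)
Lemma bilinear_walk_count (g : {ffun pos -> pos}) :
  \sum_(o : walks | every_edge_repeated (bilinear_edge o) &&
      (class_rep (bilinear_edge o) == g)) (\prod_p `|a (o p ord0) 0|)
    * n%:R^-1 ^+ #|[pred e | g e == e]| <= 1.
Proof.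
pose A (o : walks) := every_edge_repeated (bilinear_edge o) &&
      (class_rep (bilinear_edge o) == g).
(* [Tp] selects the walks whose start must be recorded: the first step represents its own edge, and
   this edge occurs only as a first step. *)
pose Tp p := (g (p, ord0) == (p, ord0)) &&
  [forall e : pos, (g e == (p, ord0)) ==> (e.2 == ord0)].
pose F (y : {ffun {e | g e == e} -> 'I_n} * {ffun {p | Tp p} -> 'I_n}) : R :=
  \prod_p (a (y.2 p) 0 ^+ 2).
pose code (o : walks) : {ffun {e | g e == e} -> 'I_n} * {ffun {p | Tp p} -> 'I_n} :=
  ([ffun e => (bilinear_edge o (val e)).2], [ffun p => o (val p) ord0]).
have repE o e : A o -> bilinear_edge o (g e) = bilinear_edge o e.
  by case/andP => _ /eqP <-; rewrite class_repE.
have gK o e : A o -> g (g e) = g e.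
  by case/andP => _ /eqP <-; rewrite class_repK.
have st0 (o : walks) p : o p ord0 = (bilinear_edge o (p, ord0)).1.
  by congr (o p _); exact: val_inj.
have code_inj : {in A &, injective code}.
  move=> o o' Ao Ao' [/ffunP heads /ffunP starts].
  have headE e : (bilinear_edge o e).2 = (bilinear_edge o' e).2.
    rewrite -(repE o) // -(repE o' e) //.
    have gge : g (g e) == g e by rewrite (gK o).
    by have := heads (exist _ (g e) gge); rewrite !ffunE.
  have tailE (e : pos) : e.2 != ord0 -> (bilinear_edge o e).1 = (bilinear_edge o' e).1.
    case: e => p t /= t0.
    have [u tu] : exists u : 'I_s, t = lift ord0 u.
      by case: (unliftP ord0 t) t0 => [u ->|->]; [exists u | rewrite eqxx].
    have -> : step_tail t = lift ord0 (step_tail u) by rewrite tu; exact: val_inj.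
    exact: (headE (p, step_tail u)).
  (* The start is the tail of the edge of the first step. If some step in the class of that edge is
     not a first step, the tail is the head of its predecessor; otherwise the code records it. *)
  have startE p : o p ord0 = o' p ord0.
    rewrite !st0 -(repE o) // -(repE o' (p, ord0)) //.
    case ge: (g (p, ord0)) => [p' t']; have [t'0|] := eqVneq t' ord0; last first.
      by move=> ?; rewrite tailE.
    rewrite {}t'0 in ge *; have [Tp'|] := boolP (Tp p').
      by have := starts (exist _ p' Tp'); rewrite !ffunE -!st0.
    rewrite negb_and -ge (gK o) // eqxx orFb => /forallPn[e].
    rewrite negb_imply => /andP[/eqP gee e0].
    by rewrite -gee !repE // tailE.
  apply/ffunP => p; apply/ffunP => x.
  case: (unliftP ord0 x) => [y ->|->]; last exact: startE.
  exact: (headE (p, y)).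
have weight_le o : A o -> \prod_p `|a (o p ord0) 0| <= F (code o).
  move=> Ao; rewrite /F (eq_bigr (fun p : {p | Tp p} => a (o (val p) ord0) 0 ^+ 2)); last first.
    by move=> p _; rewrite ffunE.
  rewrite -(big_sub Tp (fun p => a (o p ord0) 0 ^+ 2)).
  rewrite [leRHS]big_mkcond /=.
  (* Walks are grouped by the walk that represents their first step. In a group with [Tp p],
     repetition supplies a second walk q with the same start x, and the two weights give a_x^2; all
     other weights are at most 1. *)
  rewrite (partition_big (fun q => (g (q, ord0)).1) predT) //=.
  apply: ler_prod => p _; rewrite prodr_ge0 //=.
  have le1 (Q : pred 'I_K) : \prod_(q | Q q) `|a (o q ord0) 0| <= 1.
    by apply: prodr_ile1 => q _; rewrite normr_ge0 unit_entry_le1.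
  case: ifPn => [|_]; last exact: le1.
  rewrite /in_mem /= => /andP[/eqP gp /forallP only_first].
  have /andP[/forallP rpt /eqP repg] := Ao.
  have /existsP[[q t] /andP[neq /eqP eqe]] := rpt (p, ord0).
  have gq : g (q, t) = (p, ord0) by rewrite -gp -repg; exact: class_rep_eq.
  have := only_first (q, t); rewrite gq eqxx /= => /eqP t0.
  rewrite {}t0 in neq eqe gq.
  have qp : q != p by apply: contraNneq neq => ->.
  rewrite (bigD1 p) ?gp //= (bigD1 q) /=; last by rewrite gq eqxx.
  have -> : o q ord0 = o p ord0 by rewrite !st0 eqe.
  rewrite mulrA -expr2 real_normK ?num_real // ler_piMr ?sqr_ge0 //.
have F_ge0 y : 0 <= F y by apply: prodr_ge0 => p _; exact: sqr_ge0.
(* Each recorded head is free and gives a factor n; each recorded start sums to 1 because a is a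
   unit vector. *)
have sumF : \sum_y F y = n%:R ^+ #|[pred e | g e == e]|.
  rewrite -(pair_bigA _ (fun h x => F (h, x))) /= /F /=.
  rewrite -(bigA_distr_bigA (fun (_ : {p | Tp p}) x => a x 0 ^+ 2)) /=.
  rewrite [X in \sum_(_ | _) X](_ : _ = 1); last by rewrite big1.
  by rewrite sumr_const card_ffun card_ord card_sig natrX.
rewrite -mulr_suml exprVn ler_pdivrMr ?exprn_gt0 ?ltr0n // mul1r -sumF.
apply: le_trans (sum_comp_inj_le code_inj F_ge0).
by apply: ler_sum => o; exact: weight_le.
Qed.
End BilinearWalkCount.

Section AlternatingWalkCount.
Context (R : realType) (n N : nat).
Hypothesis n_gt0 : (0 < n)%N.

(** Even steps come from A^T, so the entry of A that they use is the reversed pair. *)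
Definition alternating_edge (o : {ffun 'I_N.+1 -> 'I_n}) (t : 'I_N) : 'I_n * 'I_n :=
  if odd t then (o (step_tail t), o (step_head t))
  else (o (step_head t), o (step_tail t)).

(** A walk is rebuilt from left to right out of its start and the heads of the representative steps.
    A step that is not a representative repeats an earlier edge, both ends of which are known, and
    the parity of the step tells which end is the head. The start accounts for the factor n. *)
Lemma alternating_walk_count (g : {ffun 'I_N -> 'I_N}) :
  \sum_(o | every_edge_repeated (alternating_edge o) &&
      (class_rep (alternating_edge o) == g)) (1 : R)
    * n%:R^-1 ^+ #|[pred e | g e == e]| <= n%:R.
Proof.
pose A (o : {ffun 'I_N.+1 -> 'I_n}) := every_edge_repeated (alternating_edge o) &&
      (class_rep (alternating_edge o) == g).
pose code (o : {ffun 'I_N.+1 -> 'I_n}) : 'I_n * {ffun {e | g e == e} -> 'I_n} :=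
  (o ord0, [ffun e => o (step_head (val e))]).
have code_inj : {in A &, injective code}.
  move=> o o' Ao Ao' [start /ffunP heads].
  have agree (m : nat) (lt_m : (m < N.+1)%N) : o (Ordinal lt_m) = o' (Ordinal lt_m).
    elim/ltn_ind: m lt_m => -[_ lt0|t IH lt_t].
      by have -> : Ordinal lt0 = ord0 by exact: val_inj.
    have tN : (t < N)%N by [].
    have -> : Ordinal lt_t = step_head (Ordinal tN) by exact: val_inj.
    have [fixed|nfixed] := boolP (g (Ordinal tN) == Ordinal tN).
      by have := heads (exist _ (Ordinal tN) fixed); rewrite !ffunE.
    have rt : (g (Ordinal tN) < t)%N.
      have : (g (Ordinal tN) <= Ordinal tN)%N.
        have /andP[_ /eqP <-] := Ao; have := class_rep_min (alternating_edge o) (Ordinal tN).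
        by rewrite !enum_rank_ord.
      by rewrite leq_eqVlt => /orP[|//]; rewrite val_eqE (negbTE nfixed).
    have IHtail : o (step_tail (g (Ordinal tN))) = o' (step_tail (g (Ordinal tN))).
      by have := IH _ (leqW rt) (ltn_ord (step_tail (g (Ordinal tN))));
         rewrite (_ : Ordinal _ = step_tail (g (Ordinal tN))) //; exact: val_inj.
    have IHhead : o (step_head (g (Ordinal tN))) = o' (step_head (g (Ordinal tN))).
      have lt_h : ((g (Ordinal tN)).+1 < N.+1)%N by rewrite ltnS; exact: ltn_ord.
      have := IH (g (Ordinal tN)).+1 _ lt_h; rewrite ltnS => /(_ rt).
      by rewrite (_ : Ordinal _ = step_head (g (Ordinal tN))) //; exact: val_inj.
    have edgeE (q : {ffun 'I_N.+1 -> 'I_n}) : A q ->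
        alternating_edge q (g (Ordinal tN)) = alternating_edge q (Ordinal tN).
      by case/andP => _ /eqP <-; rewrite class_repE.
    have := edgeE o Ao; have := edgeE o' Ao'; rewrite /alternating_edge.
    by case: ifP => _; case: ifP => _ [e1 e2] [e3 e4]; congruence.
  by apply/ffunP => -[m lt_m]; exact: agree.
rewrite -mulr_suml exprVn ler_pdivrMr ?exprn_gt0 ?ltr0n //.
apply: le_trans (sum_comp_inj_le (F := fun=> 1 : R) code_inj _) _ => //.
rewrite sumr_const card_prod card_ffun card_ord card_sig.
by rewrite natrM natrX.
Qed.

End AlternatingWalkCount.

(** * Moments of traces and bilinear forms *)

Section WalkMoments.
Context (d : measure_display) (T : measurableType d) (R : realType).
Variable P : probability T R.
Local Notation bm := (@bounded_measurable d T R).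
Local Notation Ex f := (Rintegral P setT f).

Context (n : nat) (Y : 'I_n * 'I_n -> T -> R) (L q : R).
Hypothesis n_gt0 : (0 < n)%N.
Hypothesis L0 : 0 <= L.
Hypothesis q0 : 0 <= q.
Hypothesis Ybm : forall i, bm (Y i).
Hypothesis Yindep : forall m : 'I_n * 'I_n -> nat,
  Ex (fun w => \prod_i Y i w ^+ m i) = \prod_i Ex (fun w => Y i w ^+ m i).
Hypothesis Ymean : forall i, Ex (Y i) = 0.
Hypothesis Ymoment : forall i m, (2 <= m)%N ->
  `|Ex (fun w => Y i w ^+ m)| <= L ^+ m * n%:R^-1 * q ^+ m.-1.

Definition entries_mx (w : T) : 'M[R]_n := \matrix_(i, j) Y (i, j) w.

Definition alternating_trace (A : 'M[R]_n) (N : nat) : R :=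
  \sum_i matrix_word (fun t => if odd t then A else A^T) N (delta_mx i 0) i 0.

Lemma alternating_traceE w N : alternating_trace (entries_mx w) N =
  \sum_(o : {ffun 'I_N.+1 -> 'I_n}) (o ord0 == o ord_max)%:R *
     \prod_t Y (alternating_edge o t) w.
Proof.
rewrite /alternating_trace.
under eq_bigr => i _ do rewrite matrix_wordE.
rewrite (exchange_big_dep predT) //=; apply: eq_bigr => o _.
rewrite (big_pred1 (o ord0)) => [|j]; last by rewrite eq_sym.
rewrite mulrC mxE eqxx andbT eq_sym; congr (_ * _); apply: eq_bigr => t _.
by rewrite /alternating_edge; case: ifP => _; rewrite !mxE.
Qed.

Theorem Ex_alternating_trace_le N :
  `|Ex (fun w => alternating_trace (entries_mx w) N)|
    <= n%:R * (L * (1 + N%:R * q)) ^+ N.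
Proof.
under eq_Rintegral do rewrite alternating_traceE.
rewrite -[in leRHS](card_ord N).
have p0 : 0 <= n%:R^-1 :> R by rewrite invr_ge0.
apply: (Ex_weighted_sum_le L0 p0 q0 Ybm Yindep Ymean Ymoment).
move=> g; apply: le_trans (alternating_walk_count R n_gt0 g).
apply: ler_sum => o _; apply: ler_wpM2r; first by rewrite exprn_ge0 ?invr_ge0.
by rewrite normr_nat lern1 leq_b1.
Qed.

Lemma bilinear_powerE (a v : 'cV[R]_n) s K w :
  ((a^T *m iter s.+1 (mulmx (entries_mx w)) v) 0 0) ^+ K =
  \sum_(o : {ffun 'I_K -> {ffun 'I_s.+2 -> 'I_n}})
    (\prod_p (a (o p ord0) 0 * v (o p ord_max) 0)) *
    \prod_e Y (bilinear_edge o e) w.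
Proof.
have -> : (a^T *m iter s.+1 (mulmx (entries_mx w)) v) 0 0 =
  \sum_(f : {ffun 'I_s.+2 -> 'I_n}) (a (f ord0) 0 * v (f ord_max) 0) *
      \prod_(t < s.+1) Y (f (step_tail t), f (step_head t)) w.
  rewrite -matrix_word_const mxE.
  under eq_bigr => i _ do rewrite matrix_wordE mulr_sumr.
  rewrite (exchange_big_dep predT) //=; apply: eq_bigr => f _.
  rewrite (big_pred1 (f ord0)) => [|j]; last by rewrite eq_sym.
  rewrite mxE mulrCA mulrC; congr (_ * _).
  by apply: eq_bigr => t _; rewrite mxE.
rewrite -[in LHS](card_ord K) -prodr_const bigA_distr_bigA /=.
apply: eq_bigr => o _; rewrite big_split /=; congr (_ * _).
by rewrite pair_bigA.
Qed.

(** Each of the K walks pays [v_max] at its end, while the start weights stay inside the count: the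
    only control on [a] is its Euclidean norm. *)
Theorem Ex_bilinear_power_le (a v : 'cV[R]_n) (v_max : R) s K :
  \sum_i a i 0 ^+ 2 = 1 -> (forall i, `|v i 0| <= v_max) ->
  `|Ex (fun w => ((a^T *m iter s.+1 (mulmx (entries_mx w)) v) 0 0) ^+ K)|
    <= v_max ^+ K * (L * (1 + (K * s.+1)%:R * q)) ^+ (K * s.+1).
Proof.
move=> a1 vv; under eq_Rintegral do rewrite bilinear_powerE.
have -> : (K * s.+1)%N = #|{: 'I_K * 'I_s.+1}| by rewrite card_prod !card_ord.
have p0 : 0 <= n%:R^-1 :> R by rewrite invr_ge0.
apply: (Ex_weighted_sum_le L0 p0 q0 Ybm Yindep Ymean Ymoment).
have v0 : 0 <= v_max by apply: le_trans (vv (Ordinal n_gt0)).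
move=> g; rewrite -[leRHS]mulr1; rewrite -mulr_suml.
apply: le_trans (ler_wpM2l (exprn_ge0 K v0) (bilinear_walk_count n_gt0 a1 g)).
rewrite -mulr_suml mulrA mulr_sumr; apply: ler_wpM2r.
  by rewrite exprn_ge0 ?invr_ge0.
apply: ler_sum => o _; rewrite normr_prod.
under eq_bigr do rewrite normrM.
rewrite big_split /= mulrC ler_wpM2r ?prodr_ge0 //.
rewrite -[in leRHS](card_ord K) -prodr_const; apply: ler_prod => p _.
by rewrite normr_ge0 vv.
Qed.

End WalkMoments.

(** * Tail bounds for the noise matrix *)

Section Truncation.
Context (R : realType).

(** This map is odd, so a symmetric law stays centred, and it never increases |x|, so the second
    moment stays below the variance of a centred variable. *)
Definition truncate (B x : R) : R := if `|x| <= B then x else 0.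

Lemma measurable_truncate B : measurable_fun [set: R] (truncate B).
Proof.
apply: measurable_fun_ifT => //.
by apply: measurable_fun_ler => //; exact: measurableT_comp.
Qed.

Lemma truncate_le B x : 0 <= B -> `|truncate B x| <= B.
Proof. by rewrite /truncate; case: ifP => // _; rewrite normr0. Qed.

Lemma truncateN B x : truncate B (- x) = - truncate B x.
Proof. by rewrite /truncate normrN; case: ifP => // _; rewrite oppr0. Qed.

Context (d : measure_display) (T : measurableType d).
Variable P : probability T R.
Local Notation bm := (@bounded_measurable d T R).
Local Notation Ex f := (Rintegral P setT f).

Lemma truncate_bm B (X : {RV P >-> R}) : 0 <= B -> bm (fun w => truncate B (X w)).
Proof.
move=> B0; apply: (bm_comp (measurable_truncate B)); last exact: measurable_funP.
by move=> x; exact: truncate_le.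
Qed.

Lemma Ex_truncate_bounded B (X : {RV P >-> R}) :
  {ae P, forall w, (`|X w| <= B)%R} -> ('E_P[X] = 0)%E ->
  Ex (fun w => truncate B (X w)) = 0.
Proof.
move=> XB; rewrite expectation_def /Rintegral => EX0.
suff -> : (\int[P]_w (truncate B (X w))%:E = \int[P]_w (X w)%:E)%E by rewrite EX0.
apply: (@ae_eq_integral _ _ _ P setT (fun w => (X w)%:E)) => //.
- apply/measurable_EFinP; apply: measurableT_comp => //.
  exact: measurable_truncate.
- exact/measurable_EFinP.
- by apply: filterS XB => w XwB _; rewrite /truncate XwB.
Qed.

(** Transfer from X to -X shows that the expectation equals its own opposite, as [truncate] is
    odd. *)
Lemma Ex_truncate_symmetric B (X : {RV P >-> R}) : 0 <= B ->
  symmetric_distribution X -> Ex (fun w => truncate B (X w)) = 0.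
Proof.
move=> B0 symX; have mX : measurable_fun [set: T] X by exact: measurable_funP.
have mNX : measurable_fun [set: T] (fun w => - X w) by exact: measurableT_comp.
have := @Ex_transfer _ _ _ P X (fun w => - X w) (fun=> 1) (fun=> 1) (truncate B) B
  mX mNX (bm_cst _ _) (bm_cst _ _) _ (measurable_truncate B)
  (fun x => truncate_le x B0).
have -> : Ex (fun w => truncate B (X w) * 1) = Ex (fun w => truncate B (X w)).
  by apply: eq_Rintegral => w _; rewrite mulr1.
have -> : Ex (fun w => truncate B (- X w) * 1) = - Ex (fun w => truncate B (X w)).
  rewrite -mulN1r -Ex_scale; last exact: truncate_bm.
  by apply: eq_Rintegral => w _; rewrite truncateN; ring.
suff h : forall E, measurable E -> Ex (fun w => \1_E (X w) * 1) =
    Ex (fun w => \1_E (- X w) * 1) by move=> /(_ h); lra.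
move=> E mE.
have indE (Z : T -> R) : measurable_fun [set: T] Z ->
    Ex (fun w => \1_E (Z w) * 1) = fine (P (Z @^-1` E)).
  move=> mZ; rewrite -Ex_indic; last by rewrite -[X in measurable X]setTI; exact: mZ.
  by apply: eq_Rintegral => w _; rewrite mulr1.
rewrite !indE //; congr fine; exact: symX.
Qed.

Lemma Ex_truncate_sqr B (X : {RV P >-> R}) (s : R) : 0 <= B ->
  ('E_P[X] = 0)%E -> ('V_P[X] <= s%:E)%E ->
  Ex (fun w => truncate B (X w) ^+ 2) <= s.
Proof.
move=> B0 EX0 VX; rewrite -lee_fin; apply: le_trans VX.
rewrite /variance covariance.unlock EX0 expectation.unlock /Rintegral fineK; last first.
  have := integrable_fin_num measurableT (bm_integrable P (bm_exp 2 (truncate_bm X B0))).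
  exact.
apply: ge0_le_integral => //.
- by move=> w _; rewrite lee_fin sqr_ge0.
- apply/measurable_EFinP; exact: (bm_exp 2 (truncate_bm X B0)).1.
- apply/measurable_EFinP; apply: measurable_funM; apply: measurable_funB => //.
- move=> w _; rewrite lee_fin fctE /= subr0 -expr2 /truncate; case: ifP => // _.
  by rewrite expr0n sqr_ge0.
Qed.

End Truncation.

(** * Operator norm from traces *)

Section RealNorm.
Context (R : realType).

Definition sqnorm n (v : 'cV[R]_n) : R := \sum_i v i 0 ^+ 2.

Lemma sqnorm_ge0 n (v : 'cV[R]_n) : 0 <= sqnorm v.
Proof. by apply: sumr_ge0 => i _; exact: sqr_ge0. Qed.

Lemma sqnormE n (v : 'cV[R]_n) : sqnorm v = (v^T *m v) 0 0.
Proof. by rewrite mxE; apply: eq_bigr => i _; rewrite mxE expr2. Qed.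

(** Lagrange's identity: the double sum of (a_i b_j - a_j b_i)^2 is twice the deficit. *)
Lemma sum_cauchy_schwarz (I : finType) (a b : I -> R) :
  (\sum_i a i * b i) ^+ 2 <= (\sum_i a i ^+ 2) * (\sum_i b i ^+ 2).
Proof.
have : 0 <= \sum_i \sum_j (a i * b j - a j * b i) ^+ 2.
  by apply: sumr_ge0 => i _; apply: sumr_ge0 => j _; exact: sqr_ge0.
have -> : \sum_i \sum_j (a i * b j - a j * b i) ^+ 2 =
    2 * ((\sum_i a i ^+ 2) * (\sum_i b i ^+ 2) - (\sum_i a i * b i) ^+ 2).
  transitivity (\sum_i \sum_j (a i ^+ 2 * b j ^+ 2) + \sum_i \sum_j (b i ^+ 2 * a j ^+ 2)
     - 2 * \sum_i \sum_j (a i * b i * (a j * b j))).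
    rewrite mulr_sumr -big_split /= -sumrB; apply: eq_bigr => i _.
    rewrite mulr_sumr -big_split /= -sumrB; apply: eq_bigr => j _; ring.
  have E (F G : I -> R) : \sum_i \sum_j (F i * G j) = (\sum_i F i) * (\sum_j G j).
    by rewrite mulr_suml; apply: eq_bigr => i _; rewrite mulr_sumr.
  by rewrite !E expr2; ring.
by rewrite pmulr_rge0 // subr_ge0.
Qed.

Lemma dot_cauchy_schwarz n (u v : 'cV[R]_n) :
  ((u^T *m v) 0 0) ^+ 2 <= sqnorm u * sqnorm v.
Proof.
rewrite mxE (eq_bigr (fun i => u i 0 * v i 0)); last by move=> i _; rewrite mxE.
exact: sum_cauchy_schwarz.
Qed.

(** This is the square of the Frobenius norm. *)
Definition frobenius m n (A : 'M[R]_(m, n)) : R := \sum_i \sum_j A i j ^+ 2.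

Lemma sqnorm_mul_le_frobenius m n (A : 'M[R]_(m, n)) (v : 'cV[R]_n) :
  sqnorm (A *m v) <= frobenius A * sqnorm v.
Proof.
rewrite mulr_suml; apply: ler_sum => i _; rewrite mxE.
exact: sum_cauchy_schwarz.
Qed.

Lemma frobeniusE m n (A : 'M[R]_(m, n)) : frobenius A = \tr (A^T *m A).
Proof.
rewrite /frobenius exchange_big /=; apply: eq_bigr => j _; rewrite mxE.
by apply: eq_bigr => i _; rewrite mxE expr2.
Qed.

(* [gram_iter A u] satisfies (gram_iter A u)^T (gram_iter A u) = (A^T A)^(2^u). *)
Fixpoint gram_iter n (A : 'M[R]_n) (u : nat) : 'M[R]_n :=
  if u is u'.+1 then (gram_iter A u')^T *m gram_iter A u' else A.

Lemma gram_iter_sym n (A : 'M[R]_n) u : (gram_iter A u.+1)^T = gram_iter A u.+1.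
Proof. by rewrite /= trmx_mul trmxK. Qed.

(** With G the next Gram iterate, |[gram_iter A u] x|^2 = x^T G x, which Cauchy-Schwarz bounds by
    |x| |G x|. Repeated squaring thus replaces the spectral theorem for A^T A. *)
Lemma sqnorm_gram_iter n (A : 'M[R]_n) u (x : 'cV[R]_n) :
  sqnorm (A *m x) ^+ (2 ^ u) <= sqnorm x ^+ (2 ^ u).-1 * sqnorm (gram_iter A u *m x).
Proof.
elim: u => [|u IH]; first by rewrite expn0 expr1 mul1r.
rewrite expnS mulnC exprM.
apply: (@le_trans _ _ ((sqnorm x ^+ (2 ^ u).-1 * sqnorm (gram_iter A u *m x)) ^+ 2)).
  by rewrite ler_sqr ?nnegrE ?mulr_ge0 ?exprn_ge0 ?sqnorm_ge0.
rewrite exprMn -exprM.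
have -> : (2 ^ u * 2).-1 = ((2 ^ u).-1 * 2).+1.
  by have := expn_gt0 2 u; case: (2 ^ u)%N.
rewrite [X in _ <= X * _]exprSr -[leRHS]mulrA ler_wpM2l ?exprn_ge0 ?sqnorm_ge0 //.
apply: le_trans (dot_cauchy_schwarz x (gram_iter A u.+1 *m x)).
by rewrite sqnormE trmx_mul !mulmxA.
Qed.

Lemma iter_gram n (A : 'M[R]_n) u (v : 'cV[R]_n) :
  iter (2 ^ u) (fun x => A^T *m (A *m x)) v = (gram_iter A u)^T *m (gram_iter A u *m v).
Proof.
elim: u v => [|u IH] v //.
by rewrite expnS mul2n -addnn iterD !IH gram_iter_sym /= !mulmxA.
Qed.

Lemma alternating_word_even n (A : 'M[R]_n) k (v : 'cV[R]_n) :
  matrix_word (fun t => if odd t then A else A^T) k.*2 v =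
  iter k (fun x => A^T *m (A *m x)) v.
Proof.
elim: k => // k IH; rewrite doubleS iterS -IH /=.
by congr (_ *m (_ *m matrix_word _ _ _)); apply/funext => t; rewrite negbK.
Qed.

(** Both sides are tr (A^T A)^(2^u); this is why trace words have length twice a power of 2. *)
Lemma alternating_trace_pow2 n (A : 'M[R]_n) u :
  alternating_trace A (2 ^ u).*2 = frobenius (gram_iter A u).
Proof.
rewrite frobeniusE /alternating_trace /mxtrace; apply: eq_bigr => i _.
rewrite alternating_word_even iter_gram mulmxA -colE.
by rewrite mxE.
Qed.

Lemma sqnorm_mul_le_trace n (A : 'M[R]_n) u (h : R) : 0 <= h ->
  alternating_trace A (2 ^ u).*2 <= h ^+ (2 ^ u).*2 ->
  forall x, sqnorm (A *m x) <= h ^+ 2 * sqnorm x.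
Proof.
move=> h0 tr_le x; have k0 := expn_gt0 2 u.
rewrite -(@ler_pXn2r _ (2 ^ u)) ?nnegrE ?sqnorm_ge0 ?mulr_ge0 ?sqr_ge0 ?sqnorm_ge0 //.
apply: (le_trans (sqnorm_gram_iter A u x)).
rewrite exprMn -exprM mul2n.
have -> : sqnorm x ^+ (2 ^ u) = sqnorm x * sqnorm x ^+ (2 ^ u).-1.
  by rewrite -exprS prednK.
rewrite mulrA mulrC.
rewrite ler_wpM2r ?exprn_ge0 ?sqnorm_ge0 //.
apply: (le_trans (sqnorm_mul_le_frobenius _ _)).
by rewrite ler_wpM2r ?sqnorm_ge0 // -alternating_trace_pow2.
Qed.

End RealNorm.

Lemma ln2_ge_half (R : realType) : 2^-1 <= ln (2 : R).
Proof.
have h : (2 : R)^-1 <= expR (- 2^-1) by have := expR_ge1Dx (- 2^-1 : R); lra.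
have := h; rewrite -ler_ln ?posrE ?expR_gt0 // expRK lnV ?posrE // => ?; lra.
Qed.

(** With l = [up_log 2 n], the bounds (l - 1)/2 <= ln n and 1/2 <= ln n are averaged, whence the
    factor 4. *)
Lemma up_log_le_ln (R : realType) n : (2 <= n)%N ->
  (up_log 2 n)%:R / 4 <= ln (n%:R : R).
Proof.
move=> n2; have l2 := ln2_ge_half R.
have lnn : ln (2 : R) <= ln n%:R by rewrite ler_ln ?posrE ?ltr0n ?ler_nat //; lia.
have lt_n : (2 ^ (up_log 2 n).-1 < n)%N by apply: up_log_gtn.
have : ln (2 : R) *+ (up_log 2 n).-1 <= ln n%:R.
  rewrite -lnXn // ler_ln ?posrE ?exprn_gt0 ?ltr0n //; last by lia.
  by rewrite -natrX ler_nat ltnW.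
have : (0 < up_log 2 n)%N by rewrite up_log_gt0.
case: (up_log 2 n) => // l _; rewrite -pred_Sn -(mulr_natl (ln 2)) -natr1 => h.
have : l%:R * 2^-1 <= l%:R * ln (2 : R) by rewrite ler_wpM2l ?ler0n.
lra.
Qed.

(** * Moments and tails of the truncated noise *)

Section NoiseEvents.
Context (d : measure_display) (T : measurableType d) (R : realType).
Variable P : probability T R.
Local Notation bm := (@bounded_measurable d T R).
Local Notation Ex f := (Rintegral P setT f).

Context (cb sigma B : R) (n : nat) (H : 'I_n -> 'I_n -> {RV P >-> R}).
Hypothesis noise : noise_assumption cb sigma B H.
Hypothesis n2 : (2 <= n)%N.

Let l := up_log 2 n.
Let L := noise_level n sigma B.
(** This is an upper bound for 1 / ln n, which gives B <= L q and sigma^2 <= L^2 q / n, while N q <=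
    16 as long as N <= 4 l. *)
Let q : R := 4 / l%:R.
Let Y (i : 'I_n * 'I_n) (w : T) : R := truncate B (H i.1 i.2 w).

Let B_gt0 : 0 < B := noise_B_gt0 noise.
Let n_gt0 : (0 < n)%N. Proof. exact: ltnW n2. Qed.
Let l_gt0 : (0 < l)%N. Proof. by rewrite up_log_gt0. Qed.
Let lR_gt0 : 0 < l%:R :> R. Proof. by rewrite ltr0n. Qed.
Let q_gt0 : 0 < q. Proof. by rewrite divr_gt0. Qed.
Let lnq : q^-1 <= ln (n%:R : R).
Proof. rewrite invf_div; exact: up_log_le_ln. Qed.
Let ln_gt0 : 0 < ln (n%:R : R).
Proof. by apply: lt_le_trans lnq; rewrite invr_gt0. Qed.

Lemma noise_level_gt0 : 0 < L.
Proof. by rewrite /L /noise_level lt_max; apply/orP; right; exact: mulr_gt0. Qed.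

Let Y_bm i : bm (Y i). Proof. by apply: truncate_bm; exact: ltW. Qed.

Let Y_indep (m : 'I_n * 'I_n -> nat) :
  Ex (fun w => \prod_i Y i w ^+ m i) = \prod_i Ex (fun w => Y i w ^+ m i).
Proof.
apply: (independent_Ex_prod (X := fun ij => H ij.1 ij.2)
  (phi := fun i x => truncate B x ^+ m i) (K := fun i => B ^+ m i)).
- exact: noise_independent noise.
- by move=> i; apply: measurable_funX; exact: measurable_truncate.
- move=> i x; rewrite normrX lerXn2r ?nnegrE ?normr_ge0 ?truncate_le //; exact: ltW.
Qed.

Let Y_mean i : Ex (Y i) = 0.
Proof.
case: (noise_tail noise i.1 i.2) => [bnd|[sym _]].
  exact: Ex_truncate_bounded bnd (noise_mean0 noise _ _).
exact: Ex_truncate_symmetric (ltW B_gt0) sym.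
Qed.

Let sigma_le : sigma ^+ 2 <= L ^+ 2 * n%:R^-1 * q.
Proof.
have s0 := noise_sigma_ge0 noise.
have nln0 : 0 <= n%:R * ln (n%:R : R) by rewrite mulr_ge0 ?ler0n // ltW.
have : sigma * Num.sqrt (n%:R * ln n%:R) <= L by rewrite /L /noise_level le_max lexx.
rewrite -ler_sqr ?nnegrE ?mulr_ge0 ?sqrtr_ge0 //; last by rewrite ltW ?noise_level_gt0.
rewrite exprMn sqr_sqrtr // => h.
rewrite -mulrA -ler_pdivrMr ?mulr_gt0 ?invr_gt0 ?ltr0n //.
apply: le_trans h; rewrite ler_wpM2l ?sqr_ge0 // invfM invrK.
by rewrite ler_wpM2l ?ler0n.
Qed.

Let B_le : B <= L * q.
Proof.
rewrite -ler_pdivrMr //; apply: le_trans (_ : B * ln n%:R <= _).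
  by rewrite ler_wpM2l // ltW.
by rewrite /L /noise_level le_max lexx orbT.
Qed.

(** Of the m factors, m - 2 are bounded by B <= L q, and the remaining square has expectation at
    most sigma^2 <= L^2 q / n. *)
Let Y_moment i m : (2 <= m)%N ->
  `|Ex (fun w => Y i w ^+ m)| <= L ^+ m * n%:R^-1 * q ^+ m.-1.
Proof.
case: m => [|[|m]] // _.
have Ym := bm_exp m.+2 (Y_bm i).
apply: (le_trans (le_normr_Rintegral _ (bm_integrable P Ym))) => //.
apply: (@le_trans _ _ (B ^+ m * Ex (fun w => Y i w ^+ 2))).
  rewrite -Ex_scale; last exact: bm_exp.
  apply: Ex_le => [||w]; first exact: bm_abs.
    by apply: bm_mul; [exact: bm_cst | exact: bm_exp].
  rewrite normrX -addn2 exprD real_normK ?num_real // ler_wpM2r ?sqr_ge0 //.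
  by rewrite lerXn2r ?nnegrE ?normr_ge0 ?truncate_le // ltW.
apply: (@le_trans _ _ (B ^+ m * sigma ^+ 2)).
  rewrite ler_wpM2l ?exprn_ge0 ?(ltW B_gt0) //.
  exact: Ex_truncate_sqr (ltW B_gt0) (noise_mean0 noise _ _) (noise_variance noise _ _).
have powE (x y z : R) : x ^+ m.+2 * z * y ^+ m.+1 = (x * y) ^+ m * (x ^+ 2 * z * y).
  by rewrite exprMn !exprS; ring.
rewrite powE.
apply: ler_pM; [by rewrite exprn_ge0 // ltW | exact: sqr_ge0 | | exact: sigma_le].
have Lq0 : 0 <= L * q by rewrite mulr_ge0 // ltW //; exact: noise_level_gt0.
by rewrite lerXn2r ?nnegrE // ltW.
Qed.

(* 17 bounds 1 + N q for N <= 4 l, and 2^6 makes (2^-6)^N <= n^-12 for N >= 2 l. *)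
Definition spectral_scale : R := 17 * 2 ^+ 6 * L.

Let h_gt0 : 0 < spectral_scale.
Proof. by apply: mulr_gt0 noise_level_gt0; apply: mulr_gt0 => //; exact: exprn_gt0. Qed.

Let ratio_le N : (2 * l <= N <= 4 * l)%N ->
  (L * (1 + N%:R * q)) ^+ N / spectral_scale ^+ N <= n%:R ^- 12.
Proof.
move=> /andP[lN Nl]; rewrite -expr_div_n.
have L_gt0 := noise_level_gt0.
have Nq : N%:R * q <= 16.
  rewrite /q mulrA ler_pdivrMr //.
  have : N%:R <= (4 * l)%:R :> R by rewrite ler_nat.
  by rewrite natrM; lra.
apply: (@le_trans _ _ ((2 ^- 6 : R) ^+ N)).
  rewrite lerXn2r ?nnegrE ?invr_ge0 ?exprn_ge0 //.
    by rewrite divr_ge0 ?mulr_ge0 ?addr_ge0 ?mulr_ge0 ?ler0n // ltW.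
  have -> : (2 ^- 6 : R) = L * 17 / spectral_scale.
    rewrite /spectral_scale; field.
    by rewrite gt_eqF.
  rewrite ler_wpM2r ?invr_ge0 ?(ltW h_gt0) // ler_wpM2l ?(ltW L_gt0) //.
  by move: Nq; lra.
rewrite exprVn lef_pV2 ?posrE ?exprn_gt0 ?ltr0n //.
rewrite -exprM -!natrX ler_nat.
apply: (@leq_trans ((2 ^ l) ^ 12)); first by rewrite leq_exp2r // up_logP.
by rewrite -expnM leq_exp2l //; lia.
Qed.

Lemma entries_bm i j : bm (fun w => entries_mx Y w i j).
Proof. by under eq_fun do rewrite mxE. Qed.

Lemma bilinear_bm (a v : 'cV[R]_n) s :
  bm (fun w => (a^T *m iter s (mulmx (entries_mx Y w)) v) 0 0).
Proof.
have it_bm t i : bm (fun w => iter t (mulmx (entries_mx Y w)) v i 0).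
  elim: t i => [|t IH] i; first exact: bm_cst.
  under eq_fun do rewrite iterS mxE.
  by apply: bm_sum => j; apply: bm_mul; [exact: entries_bm | exact: IH].
under eq_fun do rewrite mxE.
by apply: bm_sum => j; apply: bm_mul; [exact: bm_cst | exact: it_bm].
Qed.

Lemma word_trace_bm N : bm (fun w => alternating_trace (entries_mx Y w) N).
Proof.
apply: bm_sum => i.
(* Removing the first factor of the word shifts all parities, so the induction runs over both
   alternations at once. *)
suff wd_bm (b : bool) v t j : bm (fun w =>
    matrix_word (fun t => if odd t (+) b then entries_mx Y w else (entries_mx Y w)^T) t v j 0).
  have := wd_bm false (delta_mx i 0) N i; congr (bm _); apply/funext => w.
  by congr (matrix_word _ _ _ _ _); apply/funext => t; rewrite addbF.
elim: t b j => [|t IH] b j; first exact: bm_cst.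
under eq_fun do rewrite /= mxE.
apply: bm_sum => k; apply: bm_mul.
  by case: b; under eq_fun do rewrite ?mxE //=; exact: Y_bm.
have := IH (~~ b) k; congr (bm _); apply/funext => w.
by congr (matrix_word _ _ _ _ _); apply/funext => t'; rewrite addNb addbN.
Qed.

Theorem bilinear_tail (a v : 'cV[R]_n) (v_max : R) s : (s.+1 <= l)%N ->
  sqnorm a = 1 -> 0 < v_max -> (forall i, `|v i 0| <= v_max) ->
  (P [set w | (spectral_scale ^+ s.+1 * v_max <=
      `|(a^T *m iter s.+1 (mulmx (entries_mx Y w)) v) 0 0|)%R]
    <= (n%:R ^- 12)%:E)%E.
Proof.
(* The moment [K] is even, so that absolute values disappear, and the total length K (s + 1) lies
   between 2 l and 4 l whatever s is, as [ratio_le] requires. *)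
move=> sl a1 v0 vv; pose k := (l %/ s.+1).+1; pose K := k.*2.
pose X w := (a^T *m iter s.+1 (mulmx (entries_mx Y w)) v) 0 0.
have X_bm : bm X by exact: bilinear_bm.
have hv_gt0 : 0 < spectral_scale ^+ s.+1 * v_max by rewrite mulr_gt0 ?exprn_gt0.
have -> : [set w | (spectral_scale ^+ s.+1 * v_max <= `|X w|)%R] =
    [set w | ((spectral_scale ^+ s.+1 * v_max) ^+ K <= X w ^+ K)%R].
  have XK w : X w ^+ K = `|X w| ^+ K.
    by rewrite /K -mul2n !exprM real_normK ?num_real.
  apply/seteqP; split=> w /=; rewrite XK ler_pXn2r ?nnegrE ?normr_ge0 //; exact: ltW.
apply: (le_trans (markov_Ex _ _ (bm_exp K X_bm) _)).
- exact: exprn_gt0.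
- by move=> w; rewrite /K -mul2n exprM exprn_ge0 // sqr_ge0.
rewrite lee_fin.
have := Ex_bilinear_power_le n_gt0 (ltW noise_level_gt0) (ltW q_gt0) Y_bm Y_indep
  Y_mean Y_moment s K a1 vv.
move=> /(le_trans (ler_norm _)) h.
apply: (@le_trans _ _ ((L * (1 + (K * s.+1)%:R * q)) ^+ (K * s.+1) /
    spectral_scale ^+ (K * s.+1))).
  rewrite ler_pdivrMr ?exprn_gt0 //.
  have -> : (spectral_scale ^+ s.+1 * v_max) ^+ K = spectral_scale ^+ (K * s.+1) * v_max ^+ K.
    by rewrite exprMn -exprM mulnC.
  by rewrite mulrA divfK ?gt_eqF ?exprn_gt0 // mulrC.
apply: ratio_le; rewrite /K /k -muln2.
have := divn_eq l s.+1; have := ltn_pmod l (ltn0Sn s); nia.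
Qed.

Theorem trace_tail : exists u : nat,
  (P [set w | (spectral_scale ^+ (2 ^ u).*2 <=
      alternating_trace (entries_mx Y w) (2 ^ u).*2)%R]
    <= (n%:R ^- 11)%:E)%E.
Proof.
(* The least power of 2 that is at least l is at most 2 l, so the word length 2 k lies between 2 l
   and 4 l. The factor n of the trace moment turns n^-12 into n^-11. *)
exists (up_log 2 l); set k := (2 ^ _)%N.
have lk : (l <= k <= 2 * l)%N.
  rewrite up_logP //=; have [l1|l1] := leqP l 1.
    have ul0 : up_log 2 l = 0%N by apply/eqP; rewrite up_log_eq0 l1.
    by rewrite /k ul0 expn0 muln_gt0.
  have := @up_log_gtn 2 l isT l1; have : (0 < up_log 2 l)%N by rewrite up_log_gt0.
  by rewrite /k; case: (up_log 2 l) => // m _; rewrite expnS /=; lia.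
apply: (le_trans (markov_Ex _ _ (word_trace_bm k.*2) _)).
- exact: exprn_gt0.
- move=> w; rewrite alternating_trace_pow2.
  by apply: sumr_ge0 => i _; apply: sumr_ge0 => j _; exact: sqr_ge0.
rewrite lee_fin.
have := Ex_alternating_trace_le n_gt0 (ltW noise_level_gt0) (ltW q_gt0) Y_bm Y_indep
  Y_mean Y_moment k.*2.
move=> /(le_trans (ler_norm _)) h.
apply: (@le_trans _ _ (n%:R * n%:R ^- 12)); last first.
  by rewrite [n%:R ^+ 12]exprS invfM mulrA divff ?mul1r // gt_eqF ?ltr0n.
apply: (@le_trans _ _ (n%:R * ((L * (1 + k.*2%:R * q)) ^+ k.*2 / spectral_scale ^+ k.*2))).
  by rewrite mulrA ler_wpM2r // invr_ge0 exprn_ge0 // ltW.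
by rewrite ler_wpM2l // ratio_le //; lia.
Qed.

Lemma entry_tail i j : 0 < cb ->
  (P [set w | (B < `|H i j w|)%R] <= (cb * n%:R ^- 12)%:E)%E.
Proof.
move=> cb0; case: (noise_tail noise i j) => [bnd|[_ //]].
have [A [mA PA0 sub]] := bnd.
have mS : measurable [set w | (B < `|H i j w|)%R].
  have mf : measurable_fun [set: T] (fun w => B < `|H i j w|).
    by apply: measurable_fun_ltr => //; exact: measurableT_comp.
  by have := mf measurableT [set true] I; rewrite setTI.
apply: (@le_trans _ _ (P A)).
  apply: le_measure; rewrite ?inE // => w /= Bw; apply: sub => /=.
  by rewrite leNgt Bw.
by rewrite PA0 lee_fin mulr_ge0 ?invr_ge0 ?exprn_ge0 // ltW.
Qed.

End NoiseEvents.

(** * Eigenvalues and eigenvectors of the perturbed matrix *)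

Section FactorProduct.
Context (F : fieldType).

(** The factor of the head of the list is rightmost, so it acts first on column vectors. *)
Definition factor_prod n (A : 'M[F]_n) (s : seq F) : 'M[F]_n :=
  foldr (fun z X => X *m (A - z%:M)) 1%:M s.

Lemma char_poly_similar n (P A : 'M[F]_n) : P \in unitmx ->
  char_poly (P *m A *m invmx P) = char_poly A.
Proof.
move=> Pu; rewrite /char_poly /char_poly_mx.
have P'u : map_mx polyC P *m map_mx polyC (invmx P) = 1%:M.
  by rewrite -map_mxM mulmxV // map_mx1.
have -> : 'X%:M - map_mx polyC (P *m A *m invmx P) =
    map_mx polyC P *m ('X%:M - map_mx polyC A) *m map_mx polyC (invmx P).
  rewrite mulmxBr mulmxBl !map_mxM scalar_mxC -[_%:M *m _ *m _]mulmxA P'u mulmx1 //.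
by rewrite !det_mulmx mulrC mulrA [\det _ * _]mulrC -det_mulmx P'u det1 mul1r.
Qed.

Lemma char_poly_lblock m n (A : 'M[F]_m) (C : 'M[F]_(n, m)) (B : 'M[F]_n) :
  char_poly (block_mx A 0 C B) = char_poly A * char_poly B.
Proof.
rewrite /char_poly /char_poly_mx map_block_mx map_mx0 (scalar_mx_block m n).
by rewrite opp_block_mx add_block_mx oppr0 addr0 det_lblock.
Qed.

Lemma factor_prod_similar n (P A : 'M[F]_n) s : P \in unitmx ->
  factor_prod (P *m A *m invmx P) s = P *m factor_prod A s *m invmx P.
Proof.
move=> Pu; elim: s => [|z s IH] /=; first by rewrite mulmx1 mulmxV.
have -> : P *m A *m invmx P - z%:M = P *m (A - z%:M) *m invmx P.
  by rewrite mulmxBr mulmxBl scalar_mxC -[_%:M *m _ *m _]mulmxA mulmxV // mulmx1.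
by rewrite IH !mulmxA mulmxKV.
Qed.

Lemma factor_prod_lblock m n (A : 'M[F]_m) (C : 'M[F]_(n, m)) (B : 'M[F]_n) s :
  exists C', factor_prod (block_mx A 0 C B) s =
    block_mx (factor_prod A s) 0 C' (factor_prod B s).
Proof.
elim: s => [|z s [C' IH]] /=; first by exists 0; rewrite -scalar_mx_block.
exists (C' *m (A - z%:M) + factor_prod B s *m C).
rewrite IH (scalar_mx_block m n) opp_block_mx add_block_mx mulmx_block.
by rewrite !oppr0 !addr0 !mulmx0 !mul0mx !addr0 !add0r.
Qed.

(** A refinement of Cayley-Hamilton, proved by deflation. In a basis starting with a left
    eigenvector for z, A is block lower triangular with corner z. Then A - z has zero first row, so
    the rank is at most that of the product for the lower block, whose characteristic polynomial has
    lost the root z. *)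
Lemma mxrank_factor_prod_le n (A : 'M[F]_n) s1 s2 :
  char_poly A = \prod_(z <- s1 ++ s2) ('X - z%:P) ->
  (\rank (factor_prod A s2) <= size s1)%N.
Proof.
elim: s2 n A => [|z s2 IH] n A chA.
  rewrite /= mxrank1 -ltnS; have := size_char_poly A.
  by rewrite chA cats0 size_prod_XsubC => ->.
have n_gt0 : (0 < n)%N.
  have := size_char_poly A; rewrite chA size_prod_XsubC size_cat /=; lia.
case: n n_gt0 A chA => // n _ A chA.
have /eigenvalueP[v vA v0] : eigenvalue A z.
  by rewrite eigenvalue_root_char chA root_prod_XsubC mem_cat inE eqxx orbT.
(* Since v has rank 1, it is a nonzero multiple of the first row of the invertible matrix [P]. *)
pose P := row_ebase v; have Pu : P \in unitmx by exact: row_ebase_unit.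
pose e : 'rV[F]_(1 + n) := pid_mx 1.
have [c c0 eP] : exists2 c, c != 0 & v = c *: (e *m P).
  have rv : \rank v = 1%N by rewrite rank_rV v0.
  exists (col_ebase v 0 0).
    by have := col_ebase_unit v; rewrite unitmxE det_mx11 unitfE.
  rewrite -[in LHS](mulmx_ebase v) rv -mulmxA [col_ebase v]mx11_scalar mul_scalar_mx.
  by rewrite mxE mulr1n.
have eA : e *m (P *m A *m invmx P) = z *: e.
  apply: (scalerI c0).
  by rewrite !mulmxA 2!scalemxAl -eP vA -scalemxAl eP -scalemxAl mulmxK // !scalerA mulrC.
pose A2 : 'M[F]_(1 + n) := P *m A *m invmx P.
have eE : e = row_mx 1%:M 0.
  by rewrite /e pid_mx_row.
have blockE : A2 = block_mx z%:M 0 (dlsubmx A2) (drsubmx A2).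
  have : e *m block_mx (ulsubmx A2) (ursubmx A2) (dlsubmx A2) (drsubmx A2) = z *: e.
    by rewrite submxK.
  rewrite eE mul_row_block !mul1mx !mul0mx !addr0 scale_row_mx scaler0 scalemx1.
  by move=> /eq_row_mx[ul ur]; rewrite -[LHS]submxK ul ur.
have chA2 : char_poly A2 = char_poly A by exact: char_poly_similar.
have chB : char_poly (drsubmx A2) = \prod_(y <- s1 ++ s2) ('X - y%:P).
  have Xz0 : 'X - z%:P != 0 :> {poly F} by rewrite polyXsubC_eq0.
  apply: (mulfI Xz0).
  transitivity (char_poly A); last by rewrite chA !big_cat big_cons /= mulrCA.
    rewrite -[RHS]chA2 [in RHS]blockE char_poly_lblock; congr (_ * _).
    by rewrite /char_poly /char_poly_mx map_scalar_mx -rmorphB /= det_scalar1.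
suff : (\rank (factor_prod A2 (z :: s2)) <= size s1)%N.
  rewrite factor_prod_similar // mxrankMfree ?row_free_unit ?unitmx_inv //.
  have Pf : row_free P^T by rewrite row_free_unit unitmx_tr.
  rewrite -(mxrank_tr (P *m _)) trmx_mul mxrankMfree // mxrank_tr; exact.
rewrite [in factor_prod _ _]blockE /=; have [C' ->] := factor_prod_lblock z%:M (dlsubmx A2) (drsubmx A2) s2.
rewrite (scalar_mx_block 1 n) opp_block_mx add_block_mx subrr oppr0 !addr0.
rewrite subr0 mulmx_block !mulmx0 !mul0mx !add0r.
have -> : block_mx 0 0 (factor_prod (drsubmx A2) s2 *m dlsubmx A2)
    (factor_prod (drsubmx A2) s2 *m (drsubmx A2 - z%:M)) =
  col_mx 0 (factor_prod (drsubmx A2) s2 *m row_mx (dlsubmx A2) (drsubmx A2 - z%:M)).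
  by move=> k; rewrite mul_mx_row /block_mx row_mx0.
rewrite rank_col_0mx; apply: leq_trans (mxrankM_maxl _ _) _; exact: IH.
Qed.

End FactorProduct.

Import ComplexField.

(** * Complex vectors under real matrices *)

Section ComplexNorm.
Context (R : realType).
Implicit Types (z : R[i]).

Lemma sqr_cmod z : cmod z ^+ 2 = complex.Re z ^+ 2 + complex.Im z ^+ 2.
Proof. by case: z => a b /=; rewrite sqr_sqrtr // addr_ge0 ?sqr_ge0. Qed.

Lemma cmod_ge0 z : 0 <= cmod z.
Proof. by case: z => a b; exact: sqrtr_ge0. Qed.

Lemma cmodR (x : R) : cmod x%:C = `|x|.
Proof. by rewrite /= expr0n addr0 sqrtr_sqr. Qed.

Lemma cmodM z1 z2 : cmod (z1 * z2) = cmod z1 * cmod z2.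
Proof. exact: Normc.normcM. Qed.

Lemma cmodV z : cmod z^-1 = (cmod z)^-1.
Proof. exact: Normc.normcV. Qed.

Lemma cmodD z1 z2 : cmod (z1 + z2) <= cmod z1 + cmod z2.
Proof. exact: le_normcD. Qed.

Lemma cmodX z m : cmod (z ^+ m) = cmod z ^+ m.
Proof.
elim: m => [|m IH]; first by rewrite !expr0 Normc.normc1.
by rewrite !exprS cmodM IH.
Qed.

Lemma cmod_sum (I : Type) (s : seq I) (F : I -> R[i]) :
  cmod (\sum_(i <- s) F i) <= \sum_(i <- s) cmod (F i).
Proof.
elim: s => [|i s IH]; first by rewrite !big_nil Normc.normc0.
by rewrite !big_cons (le_trans (cmodD _ _)) // lerD2l.
Qed.

Definition csqnorm n (x : 'cV[R[i]]_n) : R := \sum_i cmod (x i 0) ^+ 2.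

Local Notation re x := (map_mx (@complex.Re R) x).
Local Notation im x := (map_mx (@complex.Im R) x).

Lemma csqnormE n (x : 'cV[R[i]]_n) : csqnorm x = sqnorm (re x) + sqnorm (im x).
Proof. by rewrite -big_split; apply: eq_bigr => i _; rewrite sqr_cmod !mxE. Qed.

Lemma csqnorm_ge0 n (x : 'cV[R[i]]_n) : 0 <= csqnorm x.
Proof. by apply: sumr_ge0 => i _; exact: sqr_ge0. Qed.

Lemma csqnorm_eq0 n (x : 'cV[R[i]]_n) : (csqnorm x == 0) = (x == 0).
Proof.
apply/eqP/eqP => [|->]; last by apply: big1 => i _; rewrite mxE Normc.normc0 expr0n.
move=> /eqP; rewrite psumr_eq0 => [/allP x0|i _]; last exact: sqr_ge0.
apply/matrixP => i j; rewrite ord1 mxE; apply: Normc.eq0_normc; apply/eqP.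
by have := x0 i; rewrite mem_index_enum sqrf_eq0; exact.
Qed.

Lemma csqnormD n (x y : 'cV[R[i]]_n) : csqnorm (x + y) <= 2 * csqnorm x + 2 * csqnorm y.
Proof.
rewrite !mulr_sumr -big_split; apply: ler_sum => i _; rewrite mxE !sqr_cmod.
case: (x i 0) => a b; case: (y i 0) => c e /=.
by have := sqr_ge0 (a - c); have := sqr_ge0 (b - e); nra.
Qed.

Lemma csqnormZ n z (x : 'cV[R[i]]_n) : csqnorm (z *: x) = cmod z ^+ 2 * csqnorm x.
Proof. by rewrite mulr_sumr; apply: eq_bigr => i _; rewrite mxE cmodM exprMn. Qed.

Lemma csqnormN n (x : 'cV[R[i]]_n) : csqnorm (- x) = csqnorm x.
Proof. by apply: eq_bigr => i _; rewrite mxE normcN. Qed.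

Lemma re_mulmx m n (A : 'M[R]_(m, n)) (x : 'cV[R[i]]_n) :
  re (cembed A *m x) = A *m re x.
Proof.
apply/matrixP => i j; rewrite !mxE raddf_sum; apply: eq_bigr => k _.
by rewrite !mxE; case: (x k j) => a b /=; rewrite mul0r subr0.
Qed.

Lemma im_mulmx m n (A : 'M[R]_(m, n)) (x : 'cV[R[i]]_n) :
  im (cembed A *m x) = A *m im x.
Proof.
apply/matrixP => i j; rewrite !mxE raddf_sum; apply: eq_bigr => k _.
by rewrite !mxE; case: (x k j) => a b /=; rewrite mul0r addr0.
Qed.

(** A real matrix acts separately on real and imaginary parts, so a real operator bound carries over
    with the same constant. *)
Lemma csqnorm_mulmx_le m n (A : 'M[R]_(m, n)) (c : R) :
  (forall v, sqnorm (A *m v) <= c * sqnorm v) ->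
  forall x, csqnorm (cembed A *m x) <= c * csqnorm x.
Proof. by move=> Ac x; rewrite !csqnormE re_mulmx im_mulmx mulrDr lerD. Qed.

Lemma cembedM m n p (A : 'M[R]_(m, n)) (B : 'M[R]_(n, p)) :
  cembed (A *m B) = cembed A *m cembed B.
Proof. exact: map_mxM. Qed.

Lemma cembedD m n (A B : 'M[R]_(m, n)) : cembed (A + B) = cembed A + cembed B.
Proof. exact: map_mxD. Qed.

Lemma cembedT m n (A : 'M[R]_(m, n)) : cembed A^T = (cembed A)^T.
Proof. by rewrite /cembed map_trmx. Qed.

Lemma cmod_dot_le n (a : 'cV[R]_n) (x : 'cV[R[i]]_n) :
  cmod (((cembed a)^T *m x) 0 0) ^+ 2 <= sqnorm a * csqnorm x.
Proof.
rewrite -cembedT sqr_cmod.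
have -> : complex.Re ((cembed a^T *m x) 0 0) = (a^T *m re x) 0 0 by rewrite -re_mulmx [RHS]mxE.
have -> : complex.Im ((cembed a^T *m x) 0 0) = (a^T *m im x) 0 0 by rewrite -im_mulmx [RHS]mxE.
by rewrite csqnormE mulrDr lerD // dot_cauchy_schwarz.
Qed.

End ComplexNorm.

Section Orthonormal.
Context (R : realType) (n r : nat) (U : 'M[R]_(n, r)).
Hypothesis U_orth : U^T *m U = 1%:M.

(** Pythagoras for the orthogonal projection U U^T. *)
Lemma sqnorm_split (v : 'cV[R]_n) :
  sqnorm v = sqnorm (U^T *m v) + sqnorm (v - U *m (U^T *m v)).
Proof.
have sqB (x y : 'cV[R]_n) : sqnorm (x - y) = sqnorm x - 2 * (x^T *m y) 0 0 + sqnorm y.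
  rewrite /sqnorm mxE mulr_sumr -sumrB -big_split /=; apply: eq_bigr => i _.
  by rewrite !mxE; ring.
rewrite sqB; have -> : sqnorm (U *m (U^T *m v)) = sqnorm (U^T *m v).
  by rewrite !sqnormE trmx_mul -mulmxA (mulmxA U^T) U_orth mul1mx.
have -> : (v^T *m (U *m (U^T *m v))) 0 0 = sqnorm (U^T *m v).
  by rewrite sqnormE trmx_mul trmxK mulmxA.
by ring.
Qed.

Local Notation Uc := (cembed U).

Lemma csqnorm_split (x : 'cV[R[i]]_n) :
  csqnorm x = csqnorm (Uc^T *m x) + csqnorm (x - Uc *m (Uc^T *m x)).
Proof.
rewrite -cembedT !csqnormE !map_mxB !re_mulmx !im_mulmx.
rewrite (sqnorm_split (map_mx _ x)) [X in _ + X](sqnorm_split (map_mx _ x)); ring.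
Qed.

Lemma cembed_orth : Uc^T *m Uc = 1%:M.
Proof. by rewrite -cembedT -cembedM U_orth /cembed map_mx1. Qed.

End Orthonormal.

(** * Lower bound for the top eigenvalues *)

Section EigenvalueLowerBound.
Context (R : realType) (n r : nat) (U : 'M[R]_(n, r)) (lam : 'rV[R]_r) (H : 'M[R]_n).
Context (b h : R).
Hypothesis U_orth : U^T *m U = 1%:M.
Hypothesis b_gt0 : 0 < b.
Hypothesis lam_ge : forall j, b <= `|lam 0 j|.
Hypothesis h_ge0 : 0 <= h.
Hypothesis h_le : 16 * h <= b.
Hypothesis H_le : forall v, sqnorm (H *m v) <= h ^+ 2 * sqnorm v.

Local Notation Uc := (cembed U).
Local Notation M := (cembed (U *m diag_mx lam *m U^T + H)).
Local Notation inside x := (csqnorm (Uc^T *m x)).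
Local Notation outside x := (csqnorm (x - Uc *m (Uc^T *m x))).

(* Squared norms with the crude bound [csqnormD] replace the triangle inequality
   below; this is why b / 16 and b / 4 appear. *)
Definition in_cone (x : 'cV[R[i]]_n) : Prop := outside x <= inside x /\ 0 < inside x.

(** The real part of lam_j - z already has modulus at least b - b/4. *)
Lemma csqnorm_shift_ge (z : R[i]) (p : 'cV[R[i]]_r) : cmod z <= b / 4 ->
  (3 / 4 * b) ^+ 2 * csqnorm p <= csqnorm ((cembed (diag_mx lam) - z%:M) *m p).
Proof.
move=> zb; rewrite mulr_sumr; apply: ler_sum => j _.
have -> : ((cembed (diag_mx lam) - z%:M) *m p) j 0 = ((lam 0 j)%:C - z) * p j 0.
  rewrite mulmxBl mul_scalar_mx /cembed map_diag_mx mxE mul_diag_mx !mxE.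
  by rewrite mulrBl.
rewrite cmodM [leRHS]exprMn ler_wpM2r ?sqr_ge0 // sqr_cmod.
have : complex.Re z ^+ 2 <= (b / 4) ^+ 2.
  apply: (@le_trans _ _ (cmod z ^+ 2)); first by rewrite sqr_cmod lerDl sqr_ge0.
  by rewrite lerXn2r ?nnegrE ?cmod_ge0 // divr_ge0 // ltW.
case: z zb => c e /= _ cb; have lj := lam_ge j.
have c_le : `|c| <= b / 4.
  rewrite -[leRHS]ger0_norm; last by rewrite divr_ge0 // ltW.
  by rewrite -ler_sqr ?nnegrE // !real_normK ?num_real.
have lc : 3 / 4 * b <= `|lam 0 j - c|.
  by have := ler_distD c (lam 0 j) 0; rewrite !subr0; lra.
have b34 : 0 <= 3 / 4 * b by move: b_gt0; lra.
have : (3 / 4 * b) ^+ 2 <= `|lam 0 j - c| ^+ 2 by rewrite ler_sqr ?nnegrE.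
rewrite real_normK ?num_real // => lc2; apply: (le_trans lc2).
by rewrite lerDl sqr_ge0.
Qed.

(** In units of b^2 |U^T x|^2, the noise vector H x has squared norm at most 1/128. The new inside
    part is therefore at least 9/32 - 1/128, and the new outside part at most 1/8 + 1/64. *)
Lemma in_cone_step (z : R[i]) (x : 'cV[R[i]]_n) : cmod z <= b / 4 ->
  in_cone x -> in_cone ((M - z%:M) *m x).
Proof.
move=> zb [cone pos]; set x' := _ *m x.
pose p := Uc^T *m x; pose y := cembed H *m x.
have y_le : csqnorm y <= 2 * h ^+ 2 * csqnorm p.
  apply: (le_trans (csqnorm_mulmx_le H_le x)).
  rewrite (csqnorm_split U_orth x) -/p -mulrA mulrCA ler_wpM2l ?sqr_ge0 //.
  by move: cone; rewrite -/p; lra.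
have := csqnorm_split U_orth y.
have := csqnorm_ge0 (Uc^T *m y); have := csqnorm_ge0 (y - Uc *m (Uc^T *m y)).
set yi := csqnorm (Uc^T *m y); set yo := csqnorm (y - Uc *m (Uc^T *m y)) => yo0 yi0 yE.
have UU := cembed_orth U_orth.
have x'E : x' = Uc *m (cembed (diag_mx lam) *m p) + y - z *: x.
  by rewrite /x' mulmxBl cembedD mulmxDl mul_scalar_mx !cembedM cembedT /p /y !mulmxA.
have pE : Uc^T *m x' = (cembed (diag_mx lam) - z%:M) *m p + Uc^T *m y.
  rewrite x'E mulmxBr mulmxDr (mulmxA Uc^T Uc) UU mul1mx -scalemxAr -/p.
  by rewrite mulmxBl mul_scalar_mx addrAC.
have qE : x' - Uc *m (Uc^T *m x') =
    (y - Uc *m (Uc^T *m y)) - z *: (x - Uc *m p).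
  rewrite pE mulmxDr mulmxBl mulmxBr mul_scalar_mx -scalemxAr x'E scalerBr.
  move: (Uc *m (cembed _ *m p)) (z *: x) (Uc *m (_ *m y)) (z *: (_ *m p)) => A1 A2 A3 A4.
  by apply/matrixP => i j; rewrite !mxE; ring.
have zb2 : cmod z ^+ 2 <= (b / 4) ^+ 2.
  by rewrite lerXn2r ?nnegrE ?cmod_ge0 // divr_ge0 // ltW.
have outs : outside x' <= 2 * yo + 2 * ((b / 4) ^+ 2 * csqnorm p).
  rewrite qE; apply: (le_trans (csqnormD _ _)); rewrite csqnormN csqnormZ lerD2l.
  rewrite ler_wpM2l //; apply: ler_pM => //; first exact: sqr_ge0.
  exact: csqnorm_ge0.
have ins : (3 / 4 * b) ^+ 2 * csqnorm p <= 2 * inside x' + 2 * yi.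
  apply: (le_trans (csqnorm_shift_ge _ zb)).
  have -> : (cembed (diag_mx lam) - z%:M) *m p = Uc^T *m x' + - (Uc^T *m y).
    by rewrite pE addrK.
  by rewrite (le_trans (csqnormD _ _)) // csqnormN.
have h2 : h ^+ 2 <= (b / 16) ^+ 2.
  rewrite lerXn2r ?nnegrE // ?divr_ge0 ?(ltW b_gt0) //; move: h_le; lra.
have P0 : 0 < csqnorm p by [].
have b2 : 0 < b ^+ 2 by exact: exprn_gt0.
have bp : 0 < b ^+ 2 * csqnorm p by exact: mulr_gt0.
have hp : h ^+ 2 * csqnorm p <= b ^+ 2 * csqnorm p / 256.
  apply: (le_trans (ler_wpM2r (ltW P0) h2)); lra.
by split; lra.
Qed.

Lemma in_cone_factor_prod (s : seq R[i]) (x : 'cV[R[i]]_n) :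
  {in s, forall z, cmod z <= b / 4} -> in_cone x -> in_cone (factor_prod M s *m x).
Proof.
elim: s x => [|z s IH] x small_s cone_x; first by rewrite mul1mx.
rewrite /= -mulmxA; apply: IH => [y ys|].
  by apply: small_s; rewrite inE ys orbT.
by apply: in_cone_step => //; apply: small_s; rewrite inE eqxx.
Qed.

Lemma mxrank_factor_prod_ge (s : seq R[i]) :
  {in s, forall z, cmod z <= b / 4} -> (r <= \rank (factor_prod M s))%N.
Proof.
move=> small_s; apply: leq_trans (mxrankM_maxl (factor_prod M s) Uc).
rewrite -mxrank_tr; have /eqP -> // : row_free (factor_prod M s *m Uc)^T.
apply: inj_row_free => v /(congr1 trmx); rewrite trmx_mul trmxK trmx0 => v0.
apply: contrapT => /eqP vn0.
have cone : in_cone (Uc *m v^T).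
  have UU := cembed_orth U_orth.
  split; rewrite (mulmxA Uc^T Uc) UU mul1mx.
    rewrite subrr; have -> : csqnorm (0 : 'cV[R[i]]_n) = 0 by apply/eqP; rewrite csqnorm_eq0.
    exact: csqnorm_ge0.
  by rewrite lt0r csqnorm_ge0 csqnorm_eq0 andbT trmx_eq0.
have [_] := in_cone_factor_prod small_s cone.
rewrite (mulmxA (factor_prod M s)) v0 mulmx0; have /eqP -> : csqnorm (0 : 'cV[R[i]]_r) == 0 by rewrite csqnorm_eq0.
by rewrite ltxx.
Qed.

(** If the eigenvalue of index k were smaller, so would be all later ones. The product over
    [drop k s] would then have rank at least r by the cone argument, and at most k < r by
    [mxrank_factor_prod_le]. *)
Theorem top_eigenvalue_ge (mu : 'I_r -> R[i]) (k : 'I_r) :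
  top_eigenvalues M mu -> b / 4 <= cmod (mu k).
Proof.
move=> [s [chM srt rs muE]]; rewrite leNgt; apply/negP => small_k.
have tr : transitive (fun x y : R[i] => cmod y <= cmod x).
  by move=> y x z xy yz; exact: le_trans yz xy.
have small : {in drop k s, forall z, cmod z <= b / 4}.
  move=> z /(nthP 0)[j]; rewrite size_drop nth_drop => jlt <-.
  apply: le_trans (ltW small_k); rewrite muE.
  have [->|j0] := posnP j; first by rewrite addn0.
  have kjs : (k + j < size s)%N by rewrite -ltn_subRL.
  have ks : (k < size s)%N := leq_ltn_trans (leq_addr j k) kjs.
  apply: (sorted_ltn_nth tr 0 srt); rewrite ?inE //.
  by rewrite -[ltnLHS]addn0 ltn_add2l.
have chM' : char_poly M = \prod_(z <- take k s ++ drop k s) ('X - z%:P).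
  by rewrite cat_take_drop.
have := leq_trans (mxrank_factor_prod_ge small) (mxrank_factor_prod_le chM').
have ks : (k <= size s)%N := leq_trans (ltnW (ltn_ord k)) rs.
by rewrite (size_takel ks) leqNgt ltn_ord.
Qed.

End EigenvalueLowerBound.

Lemma iter_mulmxE (F : comPzRingType) n (A : 'M[F]_n) s m (X : 'M[F]_(n, m)) :
  iter s (mulmx A) X = iter s (mulmx A) 1%:M *m X.
Proof. by elim: s => [|s IH]; rewrite ?mul1mx // !iterS IH mulmxA. Qed.

(** * Truncated Neumann series for an eigenvector *)

Section LinearFormError.
Context (R : realType) (n r : nat) (U : 'M[R]_(n, r)) (lam : 'rV[R]_r) (H : 'M[R]_n).
Context (a : 'cV[R]_n) (z : R[i]) (u : 'cV[R[i]]_n).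
Context (h v_max lmax : R) (l : nat).
Hypothesis U_orth : U^T *m U = 1%:M.
Hypothesis a_unit : sqnorm a = 1.
Hypothesis h_ge0 : 0 <= h.
Hypothesis H_le : forall v, sqnorm (H *m v) <= h ^+ 2 * sqnorm v.
Hypothesis walk_le : forall s j, (s.+1 <= l)%N ->
  `|(a^T *m iter s.+1 (mulmx H) (col j U)) 0 0| <= h ^+ s.+1 * v_max.
Hypothesis lam_le : forall j, `|lam 0 j| <= lmax.
Hypothesis eig : unit_eigenvector (cembed (U *m diag_mx lam *m U^T + H)) z u.
Hypothesis z_ge : 2 * h <= cmod z.
Hypothesis z_gt0 : 0 < cmod z.
Hypothesis v_max_ge0 : 0 <= v_max.
Hypothesis lmax_ge0 : 0 <= lmax.

Local Notation Uc := (cembed U).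
Local Notation Hc := (cembed H).
Let alpha (x : 'cV[R[i]]_n) : R[i] := ((cembed a)^T *m x) 0 0.
Let Mu : 'cV[R[i]]_n := cembed (U *m diag_mx lam *m U^T) *m u.

Let z_neq0 : z != 0.
Proof. by apply: contraTneq z_gt0 => ->; rewrite Normc.normc0 ltxx. Qed.

Let u_unit : csqnorm u = 1.
Proof.
have [_ nu] := eig; have <- : cl2norm u ^+ 2 = 1 by rewrite nu expr1n.
by rewrite sqr_sqrtr // csqnorm_ge0.
Qed.

Let alphaD x y : alpha (x + y) = alpha x + alpha y.
Proof. by rewrite /alpha mulmxDr mxE. Qed.

Let alphaZ c x : alpha (c *: x) = c * alpha x.
Proof. by rewrite /alpha -scalemxAr mxE. Qed.

Let Hpow s := iter s (mulmx H) 1%:M.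

Let cembed_Hpow s : cembed (Hpow s) = iter s (mulmx Hc) 1%:M.
Proof.
elim: s => [|s IH]; first by rewrite /Hpow /cembed map_mx1.
by rewrite [RHS]iterS -IH -cembedM.
Qed.

(** Here [Mu] is the noiseless matrix applied to u; by the spectral decomposition it is the sum of
    lam_j (u_j^T u) u_j. *)
Let errorE : linear_form_error U lam a z u = alpha u - z^-1 * alpha Mu.
Proof.
rewrite /linear_form_error -/(alpha _).
have -> : \sum_(j < r) ((lam 0 j)%:C * ((cembed (col j U))^T *m u) 0 0 / z) *: cembed (col j U)
    = z^-1 *: Mu.
  rewrite /Mu !cembedM cembedT -mulmxA; apply/matrixP => i k; rewrite ord1 summxE.
  rewrite !mxE mulr_sumr; apply: eq_bigr => j _.
  have -> : (Uc *m cembed (diag_mx lam)) i j = (U i j)%:C * (lam 0 j)%:C.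
    by rewrite /cembed map_diag_mx mul_mx_diag !mxE.
  have -> : (Uc^T *m u) j 0 = ((cembed (col j U))^T *m u) 0 0.
    by rewrite !mxE; apply: eq_bigr => k' _; rewrite !mxE.
  by rewrite !mxE; ring.
by rewrite -scaleN1r alphaD !alphaZ mulN1r.
Qed.

(** The eigenvector equation reads u = z^-1 (Mu + H u); substituting it once more in the last term
    passes from S to S + 1. *)
Let neumann S : alpha u - z^-1 * alpha Mu =
  \sum_(s < S) z^-1 ^+ s.+2 * alpha (cembed (Hpow s.+1) *m Mu)
    + z^-1 ^+ S.+1 * alpha (cembed (Hpow S.+1) *m u).
Proof.
have uE : u = z^-1 *: (Mu + Hc *m u).
  by rewrite /Mu -mulmxDl -cembedD (proj1 eig) scalerA mulVf // scale1r.
elim: S => [|S IH].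
  rewrite big_ord0 add0r expr1 /Hpow /= mulmx1 {1}uE alphaZ alphaD; ring.
rewrite IH big_ord_recr /= -addrA; congr (_ + _).
have HpowS : cembed (Hpow S.+2) *m u = cembed (Hpow S.+1) *m (Hc *m u).
  by rewrite !cembed_Hpow -!iter_mulmxE -iterSr.
rewrite HpowS [in LHS]uE -scalemxAr alphaZ mulmxDr alphaD [z^-1 ^+ S.+2]exprSr; ring.
Qed.

(** Cauchy-Schwarz over the r coordinates, with |U^T u| <= |u| = 1; this is the source of the factor
    sqrt r. *)
Let sum_coef_le : \sum_j cmod ((Uc^T *m u) j 0) <= Num.sqrt r%:R.
Proof.
have s0 : 0 <= \sum_j cmod ((Uc^T *m u) j 0) by apply: sumr_ge0 => j _; exact: cmod_ge0.
rewrite -(ger0_norm s0) -sqrtr_sqr ler_wsqrtr //.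
have := sum_cauchy_schwarz (fun=> 1) (fun j => cmod ((Uc^T *m u) j 0)).
under eq_bigr do rewrite mul1r.
move=> /le_trans; apply; rewrite (eq_bigr (fun=> 1)) => [|j _]; last by rewrite expr1n.
rewrite sumr_const card_ord ler_piMr ?ler0n // -u_unit.
by rewrite [leRHS](csqnorm_split U_orth) lerDl csqnorm_ge0.
Qed.

Let term_le s : (s.+1 <= l)%N ->
  cmod (alpha (cembed (Hpow s.+1) *m Mu)) <= h ^+ s.+1 * (lmax * v_max * Num.sqrt r%:R).
Proof.
move=> sl; pose w j := (a^T *m Hpow s.+1 *m U) 0 j * lam 0 j.
have -> : alpha (cembed (Hpow s.+1) *m Mu) = \sum_j (w j)%:C * (Uc^T *m u) j 0.
  rewrite /alpha /Mu cembedM cembedT -!mulmxA -cembedT !mulmxA -!cembedM.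
  rewrite -mulmxA mxE; apply: eq_bigr => j _.
  by rewrite mulmxA /w /cembed mxE mul_mx_diag mxE.
apply: (le_trans (cmod_sum _ _)).
apply: (@le_trans _ _ (\sum_j h ^+ s.+1 * v_max * lmax * cmod ((Uc^T *m u) j 0))).
  apply: ler_sum => j _; rewrite cmodM cmodR ler_wpM2r ?cmod_ge0 // /w normrM.
  apply: ler_pM => //; have := walk_le j sl.
  by rewrite iter_mulmxE -/(Hpow _) mulmxA !colE mulmxA -colE mxE.
rewrite -mulr_sumr; set c := Num.sqrt r%:R.
have -> : h ^+ s.+1 * (lmax * v_max * c) = h ^+ s.+1 * v_max * lmax * c by ring.
by rewrite ler_wpM2l // !mulr_ge0 // exprn_ge0.
Qed.

Let tail_le s : cmod (alpha (cembed (Hpow s) *m u)) <= h ^+ s.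
Proof.
have Hs : csqnorm (cembed (Hpow s) *m u) <= (h ^+ s) ^+ 2.
  elim: s => [|s IH]; first by rewrite /Hpow /cembed map_mx1 mul1mx u_unit expr1n.
  rewrite cembed_Hpow -iter_mulmxE iterS iter_mulmxE -cembed_Hpow [h ^+ s.+1]exprS exprMn.
  apply: (le_trans (csqnorm_mulmx_le H_le _)).
  by rewrite ler_wpM2l ?sqr_ge0.
rewrite -ler_sqr ?nnegrE ?cmod_ge0 ?exprn_ge0 //.
by apply: (le_trans (cmod_dot_le _ _)); rewrite a_unit mul1r.
Qed.

(** With t = h / |z| <= 1/2, the terms of the series carry t^(s+1) and sum to at most 2 t times
    their common factor. The remainder is at most t^(l+1), controlled by the operator norm alone. *)
Theorem linear_form_error_le : cmod (linear_form_error U lam a z u) <=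
  h / cmod z * (2 * (lmax / cmod z * v_max * Num.sqrt r%:R) + 2^-1 ^+ l).
Proof.
rewrite errorE (neumann l); apply: (le_trans (cmodD _ _)).
rewrite mulrDr; pose t := h / cmod z.
have t0 : 0 <= t by rewrite divr_ge0 ?cmod_ge0.
have t_le : t <= 2^-1 by rewrite ler_pdivrMr // ler_pdivlMl.
have tX s : t ^+ s <= 2^-1 ^+ s by rewrite lerXn2r ?nnegrE ?invr_ge0.
apply: lerD.
  apply: (le_trans (cmod_sum _ _)).
  pose c := lmax / cmod z * v_max * Num.sqrt r%:R.
  have c0 : 0 <= c by rewrite !mulr_ge0 ?invr_ge0 ?sqrtr_ge0 ?cmod_ge0.
  apply: (@le_trans _ _ (\sum_(s < l) t * c * 2^-1 ^+ s)).
    apply: ler_sum => s _; rewrite cmodM cmodX cmodV.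
    have zs0 : 0 <= (cmod z)^-1 ^+ s.+2 by rewrite exprn_ge0 // invr_ge0 cmod_ge0.
    apply: (le_trans (ler_wpM2l zs0 (term_le (ltn_ord s)))).
    have -> : (cmod z)^-1 ^+ s.+2 * (h ^+ s.+1 * (lmax * v_max * Num.sqrt r%:R)) =
        t * c * t ^+ s by rewrite /t /c !exprMn !exprS; ring.
    by rewrite ler_wpM2l ?tX // mulr_ge0.
  have tc0 : 0 <= t * c by exact: mulr_ge0.
  rewrite -mulr_sumr -/t -/c [leRHS]mulrCA [leRHS]mulrC ler_wpM2l //.
  suff -> : \sum_(s < l) 2^-1 ^+ s = 2 - 2 * 2^-1 ^+ l :> R.
    by rewrite gerBl mulr_ge0 // exprn_ge0 // invr_ge0.
  elim: l => [|l' IH]; first by rewrite big_ord0 expr0; ring.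
  by rewrite big_ord_recr /= IH exprS; field.
rewrite cmodM cmodX cmodV.
have zl0 : 0 <= (cmod z)^-1 ^+ l.+1 by rewrite exprn_ge0 // invr_ge0 cmod_ge0.
apply: (le_trans (ler_wpM2l zl0 (tail_le _))).
by rewrite mulrC -exprMn -/t exprS ler_wpM2l.
Qed.

End LinearFormError.

(** * High-probability events and the final estimate *)

Section HighProbability.
Context (d : measure_display) (T : measurableType d) (R : realType).
Variable P : probability T R.

Lemma with_probability_mono (p p' : R) (E E' : set T) : E `<=` E' -> p' <= p ->
  with_probability_at_least P p E -> with_probability_at_least P p' E'.
Proof.
move=> EE' pp' [A [mA AE pA]]; exists A; split => //; first exact: subset_trans EE'.
by apply: le_trans pA; rewrite lee_fin.
Qed.

Lemma with_probability_compl (q : R) (S : set T) : measurable S ->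
  (P S <= q%:E)%E -> with_probability_at_least P (1 - q) (~` S).
Proof.
move=> mS Sq; exists (~` S); split => //; first exact: measurableC.
by rewrite probability_setC // EFinB leeB.
Qed.

Lemma with_probability_and (q1 q2 : R) (E1 E2 : set T) :
  with_probability_at_least P (1 - q1) E1 -> with_probability_at_least P (1 - q2) E2 ->
  with_probability_at_least P (1 - (q1 + q2)) (E1 `&` E2).
Proof.
move=> [A1 [mA1 AE1 pA1]] [A2 [mA2 AE2 pA2]]; exists (A1 `&` A2); split.
- exact: measurableI.
- exact: setISS.
have cmp (A : set T) (q : R) : measurable A -> ((1 - q)%:E <= P A)%E -> (P (~` A) <= q%:E)%E.
  move=> mA; rewrite probability_setC // -[P A]fineK ?fin_num_measure // -EFinB !lee_fin; lra.
have : (P (~` (A1 `&` A2)) <= (q1 + q2)%:E)%E.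
  rewrite setCI EFinD.
  apply: (le_trans (@measureU2 _ _ _ P _ _ (measurableC mA1) (measurableC mA2))).
  by apply: leeD; exact: cmp.
rewrite probability_setC; last exact: measurableI.
rewrite -[P (A1 `&` A2)]fineK ?fin_num_measure //; last exact: measurableI.
by rewrite -EFinB !lee_fin; lra.
Qed.

Lemma with_probability_all (I : finType) (q : R) (E : I -> set T) :
  (forall i, with_probability_at_least P (1 - q) (E i)) ->
  with_probability_at_least P (1 - #|I|%:R * q) [set w | forall i, E i w].
Proof.
move=> Eq; have aux (s : seq I) : with_probability_at_least P (1 - (size s)%:R * q)
    [set w | forall i, i \in s -> E i w].
  elim: s => [|i s IH].
    exists setT; split => //.
    by rewrite mul0r subr0 (probability_setT P).
  rewrite /= -natr1 mulrDl mul1r [X in 1 - X]addrC.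
  apply: with_probability_mono (with_probability_and (Eq i) IH) => // w [Ei Es] j.
  by rewrite inE => /orP[/eqP ->|]; [exact: Ei | exact: Es].
rewrite cardT; apply: with_probability_mono (aux (enum I)) => // w Ew i.
by apply: Ew; rewrite mem_enum.
Qed.

Lemma with_probability_not_ge (f : T -> R) (t q : R) : measurable_fun [set: T] f ->
  (P [set w | (t <= f w)%R] <= q%:E)%E ->
  with_probability_at_least P (1 - q) [set w | f w < t].
Proof.
move=> mf Pq; have mS : measurable [set w | (t <= f w)%R].
  have mle : measurable_fun [set: T] (fun w => t <= f w) by exact: measurable_fun_ler.
  by have := mle measurableT [set true] I; rewrite setTI.
apply: with_probability_mono (with_probability_compl mS Pq) => // w /=.
by rewrite ltNge => /negP.
Qed.

Lemma with_probability_le0 (p : R) (E : set T) : p <= 0 -> with_probability_at_least P p E.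
Proof.
move=> p0; exists set0; split=> //.
by rewrite measure0 lee_fin.
Qed.

End HighProbability.

(** Budget for failure: n^2 entries exceeding B cost cb n^-10, the trace costs n^-11 <= n^-10, and
    the l r <= n^2 bilinear forms, at n^-12 each, cost at most n^-10. *)
Lemma noise_good_event (R : realType) (cb : R) (d : measure_display)
    (T : measurableType d) (P : probability T R) (sigma B v_max : R) (n r : nat)
    (H : 'I_n -> 'I_n -> {RV P >-> R}) (U : 'M[R]_(n, r)) (a : 'cV[R]_n) :
  0 < cb -> noise_assumption cb sigma B H -> (2 <= n)%N -> (r <= n)%N ->
  sqnorm a = 1 -> 0 < v_max -> (forall i j, `|U i j| <= v_max) ->
  with_probability_at_least P (1 - (cb + 2) * n%:R ^- 10)
    [set w | let h := spectral_scale sigma B n in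
      let A := random_matrix H w in
      (forall v, sqnorm (A *m v) <= h ^+ 2 * sqnorm v) /\
      (forall s j, (s.+1 <= up_log 2 n)%N ->
         `|(a^T *m iter s.+1 (mulmx A) (col j U)) 0 0| <= h ^+ s.+1 * v_max)].
Proof.
move=> cb0 noise n2 rn a1 v0 Uv; set l := up_log 2 n; set h := spectral_scale _ _ _.
have n0 : 0 < n%:R :> R by rewrite ltr0n (ltnW n2).
pose Y (w : T) := entries_mx (fun (i : 'I_n * 'I_n) w => truncate B (H i.1 i.2 w)) w.
have [u trE] := trace_tail noise n2.
have ev1 : with_probability_at_least P (1 - #|{: 'I_n * 'I_n}|%:R * (cb * n%:R ^- 12))
    [set w | forall ij : 'I_n * 'I_n, (`|H ij.1 ij.2 w| <= B)%R].
  apply: with_probability_all => ij.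
  have mS : measurable [set w | (B < `|H ij.1 ij.2 w|)%R].
    have mf : measurable_fun [set: T] (fun w => B < `|H ij.1 ij.2 w|).
      by apply: measurable_fun_ltr => //; exact: measurableT_comp.
    by have := mf measurableT [set true] I; rewrite setTI.
  apply: with_probability_mono (with_probability_compl mS (entry_tail noise _ _ cb0)) => // w /=.
  by rewrite leNgt => /negP.
have ev2 := with_probability_not_ge (word_trace_bm noise (2 ^ u).*2).1 trE.
have ev3 : with_probability_at_least P (1 - #|{: 'I_l * 'I_r}|%:R * n%:R ^- 12)
    [set w | forall sj : 'I_l * 'I_r,
      `|(a^T *m iter sj.1.+1 (mulmx (Y w)) (col sj.2 U)) 0 0| < h ^+ sj.1.+1 * v_max].
  apply: with_probability_all => -[s j].
  apply: with_probability_not_ge.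
    exact: (bm_abs (bilinear_bm noise a (col j U) s.+1)).1.
  by apply: (bilinear_tail noise n2) => // i; rewrite mxE.
apply: with_probability_mono (with_probability_and ev1 (with_probability_and ev2 ev3)).
  move=> w [Hw [trw bw]].
  (* When no entry exceeds B, truncation changes nothing, so the bounds for the truncated matrix
     hold for the noise itself. *)
  have YE : Y w = random_matrix H w.
    apply/matrixP => i j; rewrite !mxE /truncate.
    by have := Hw (i, j) => /= ->.
  rewrite /= -YE; split.
    apply: (sqnorm_mul_le_trace (u := u)); last exact: ltW.
    by rewrite ltW // mulr_gt0 ?(noise_level_gt0 noise) ?mulr_gt0 ?exprn_gt0.
  by move=> s j sl; have := bw (Ordinal sl, j); exact: ltW.
rewrite lerD2l lerN2 !card_prod !card_ord.
have ln : (l <= n)%N by apply: up_log_min => //; exact: ltnW (ltn_expl n _).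
have lr : (l * r)%:R <= (n * n)%:R :> R by rewrite ler_nat leq_mul.
have n1 : 1 <= n%:R :> R by rewrite ler1n (ltnW n2).
have i12 : (n * n)%:R * n%:R ^- 12 = n%:R ^- 10 :> R.
  rewrite natrM; move: (n%:R : R) n0 => x x0; field; by rewrite gt_eqF.
have i11 : n%:R ^- 11 <= n%:R ^- 10 :> R.
  by rewrite lef_pV2 ?posrE ?exprn_gt0 // ler_weXn2l.
have i0 : 0 <= n%:R ^- 12 :> R by rewrite invr_ge0 exprn_ge0 // ltW.
have : (l * r)%:R * n%:R ^- 12 <= n%:R ^- 10 :> R by rewrite -i12 ler_wpM2r.
rewrite mulrCA i12; lra.
Qed.

Theorem theorem4 (R : realType) (cb : R) (cb_gt0 : 0 < cb) :
  exists c1 C C' : R, [/\ 0 < c1, 0 < C & 0 < C'] /\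
  forall (n r : nat) (r_gt0 : (0 < r)%N)
    (Mstar : 'M[R]_n) (Ustar : 'M[R]_(n, r)) (lamstar : 'rV[R]_r) (mu : R)
    (d : measure_display) (T : measurableType d) (P : probability T R)
    (sigma B : R) (H : 'I_n -> 'I_n -> {RV P >-> R})
    (lam : T -> 'I_r -> R[i]) (u : T -> 'I_r -> 'cV[R[i]]_n),
  let lmax := lambda_max r_gt0 lamstar in
  let kappa := condition_number r_gt0 lamstar in
  let M := fun w : T => cembed (Mstar + random_matrix H w) in
  let L := noise_level n sigma B in
  low_rank_eigendecomp Mstar Ustar lamstar ->
  incoherence_parameter Ustar mu ->
  noise_assumption cb sigma B H ->
  L / lmax <= c1 / kappa ->
  (forall w, top_eigenvalues (M w) (lam w)) ->
  (forall w l, unit_eigenvector (M w) (lam w l) (u w l)) ->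
  forall (a : 'cV[R]_n) (l : 'I_r), l2norm a = 1 ->
  with_probability_at_least P (1 - C' * n%:R ^- 10)
    [set w |
      (* makes the divisions by lambda_l meaningful, as x / 0 = 0 here *)
      [/\ lam w l != 0,
          cmod (linear_form_error Ustar lamstar a (lam w l) (u w l))
            <= C * L * (kappa / cmod (lam w l)) * Num.sqrt (mu * r%:R / n%:R)
        & L * (kappa / cmod (lam w l)) * Num.sqrt (mu * r%:R / n%:R)
            <= C * (L / lmax) * kappa ^+ 2 * Num.sqrt (mu * r%:R / n%:R)]].
Proof.
pose C0 : R := 17 * 2 ^+ 6.
have C0_gt0 : 0 < C0 by rewrite mulr_gt0 ?exprn_gt0.
(* The first constant yields 16 h <= lambda_min with h = C0 L. In the second, 9 = 2 * 4 + 1: twice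
   the bound 4 kappa on lambda_max / |z|, plus 1 for the remainder. The third is the budget of
   [noise_good_event]. *)
exists ((16 * C0)^-1), (9 * C0), (cb + 2); split.
  by split; [rewrite invr_gt0 mulr_gt0 | rewrite mulr_gt0 | rewrite addr_gt0].
move=> n r r_gt0 Mstar U lamstar mu d T P sigma B H lam u lmax kappa M L.
move=> [_ rkM U_orth ME sorted_lam lam_neq0] [[mu0 Umu] _] noise small topE eigE a l a1.
have rn : (r <= n)%N by rewrite -rkM rank_leq_row.
(* For n = 1 the required probability 1 - (cb + 2) is negative and nothing is claimed. *)
have [n1|n2] := leqP n 1.
  have nE : n%:R = 1 :> R by apply/eqP; rewrite pnatr_eq1 eqn_leq n1 (leq_trans r_gt0 rn).
  by apply: with_probability_le0; rewrite nE expr1n invr1 mulr1; lra.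
have n0 : 0 < n%:R :> R by rewrite ltr0n (ltnW n2).
have sq_a : sqnorm a = 1.
  have <- : l2norm a ^+ 2 = 1 by rewrite a1 expr1n.
  by rewrite sqr_sqrtr // sqnorm_ge0.
(* A column of U has unit norm and n entries of square at most mu / n. This makes [v_max] positive
   and gives 1/n <= [v]. *)
have mu_ge1 : 1 <= mu.
  have : (U^T *m U) (Ordinal r_gt0) (Ordinal r_gt0) = 1 by rewrite U_orth mxE eqxx.
  rewrite mxE => <-; apply: (@le_trans _ _ (\sum_(i < n) mu / n%:R)).
    apply: ler_sum => i _; rewrite mxE -expr2 -real_normK ?num_real //.
    rewrite -[leRHS]sqr_sqrtr ?divr_ge0 ?ler0n // lerXn2r ?nnegrE ?sqrtr_ge0 //.
  by rewrite sumr_const card_ord -(mulr_natr (mu / n%:R)) divfK // gt_eqF.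
pose v_max := Num.sqrt (mu / n%:R); pose v := Num.sqrt (mu * r%:R / n%:R).
have v_max_gt0 : 0 < v_max by rewrite sqrtr_gt0 divr_gt0 // (lt_le_trans ltr01).
have vE : v = v_max * Num.sqrt r%:R.
  by rewrite /v mulrAC sqrtrM // divr_ge0 // ltW.
pose lmin := lambda_min r_gt0 lamstar.
have lmin_gt0 : 0 < lmin by rewrite normr_gt0.
have lmin_le j : lmin <= `|lamstar 0 j| by apply: sorted_lam => /=; have := ltn_ord j; lia.
have lmax_ge j : `|lamstar 0 j| <= lmax by apply: sorted_lam.
have lmax_gt0 : 0 < lmax by rewrite normr_gt0.
have kappaE : kappa = lmax / lmin by [].
have kappa_ge1 : 1 <= kappa by rewrite kappaE ler_pdivlMr // mul1r lmin_le.
have L_gt0 : 0 < L by exact: noise_level_gt0 noise n2.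
pose h := spectral_scale sigma B n.
have hE : h = C0 * L by [].
have h_gt0 : 0 < h by rewrite hE mulr_gt0.
have h_small : 16 * h <= lmin.
  move: small; rewrite kappaE invf_div mulrA ler_pM2r ?invr_gt0 //.
  by rewrite ler_pdivlMl ?mulr_gt0 // hE mulrA.
apply: with_probability_mono (noise_good_event cb_gt0 noise n2 rn sq_a v_max_gt0 Umu) => //.
move=> w [H_le walk_le]; set z := lam w l.
have ME' : M w = cembed (U *m diag_mx lamstar *m U^T + random_matrix H w) by rewrite /M -ME.
have z_ge : lmin / 4 <= cmod z.
  apply: (top_eigenvalue_ge U_orth lmin_gt0 lmin_le (ltW h_gt0) h_small H_le).
  by rewrite -ME'.
have z_gt0 : 0 < cmod z by apply: lt_le_trans z_ge; rewrite divr_gt0.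
have lmax_z : lmax / cmod z <= 4 * kappa.
  rewrite kappaE mulrA ler_pdivrMr // mulrAC ler_pdivlMr //.
  by rewrite [4 * _]mulrC -mulrA ler_wpM2l ?(ltW lmax_gt0) //; move: z_ge; lra.
have z2h : 2 * h <= cmod z by apply: le_trans z_ge; lra.
have v_ge0 : 0 <= v by exact: sqrtr_ge0.
have inv_n_le : n%:R^-1 <= v.
  have -> : n%:R^-1 = Num.sqrt (n%:R ^- 2) :> R.
    by rewrite -exprVn sqrtr_sqr ger0_norm // invr_ge0 ltW.
  rewrite ler_wsqrtr // expr2 invfM ler_wpM2r ?invr_ge0 ?(ltW n0) //.
  have n_inv : n%:R^-1 <= 1 :> R by rewrite invf_le1 // ler1n (ltnW n2).
  apply: (le_trans n_inv); rewrite -[leLHS]mulr1 ler_pM // ler1n //.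
split.
- by apply/eqP => z0; move: z_gt0; rewrite [z]z0 Normc.normc0 ltxx.
- have err := linear_form_error_le U_orth sq_a (ltW h_gt0) H_le walk_le lmax_ge _ z2h z_gt0
    (ltW v_max_gt0) (ltW lmax_gt0).
  have := err (u w l); rewrite -ME' => /(_ (eigE w l)) => err'.
  apply: (le_trans err').
  (* The series is cut at log2 n terms so that its remainder, at most 1/n <= v, is absorbed by the
     main term. *)
  have half_le : 2^-1 ^+ up_log 2 n <= kappa * v.
    apply: (@le_trans _ _ v); last by rewrite ler_peMl.
    apply: le_trans inv_n_le; rewrite exprVn lef_pV2 ?posrE ?exprn_gt0 //.
    by rewrite -natrX ler_nat up_logP.
  have main_le : lmax / cmod z * v_max * Num.sqrt r%:R <= 4 * kappa * v.
    by rewrite -mulrA -vE ler_wpM2r.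
  have -> : 9 * C0 * L * (kappa / cmod z) * v = h / cmod z * (9 * (kappa * v)).
    by rewrite hE; ring.
  by rewrite ler_wpM2l ?divr_ge0 ?(ltW h_gt0) ?(ltW z_gt0) //; lra.
(* The second inequality only needs |z| >= lambda_min / 4, since kappa^2 / lambda_max = kappa /
   lambda_min. *)
have -> : 9 * C0 * (L / lmax) * kappa ^+ 2 * v = L * (9 * C0 * (kappa ^+ 2 / lmax)) * v.
  by ring.
rewrite ler_wpM2r // ler_wpM2l ?(ltW L_gt0) //.
have -> : 9 * C0 * (kappa ^+ 2 / lmax) = kappa * (9 * C0 / lmin).
  by rewrite kappaE; field; rewrite !gt_eqF.
rewrite ler_wpM2l ?(le_trans _ kappa_ge1) //.
apply: (@le_trans _ _ (4 / lmin)).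
  by rewrite -invf_div lef_pV2 ?posrE ?divr_gt0.
rewrite ler_wpM2r ?invr_ge0 ?(ltW lmin_gt0) // /C0; lra.
Qed.
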